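(* Suppose $\kappa$ is the least cardinal which is an $\omega$-pseudo-chain compactness cardinal for $\mathbb{L}^2$. Then $\kappa$ is weakly virtually extendible.
   Context: $\mathbb{L}^2$ is second-order logic with standard semantics. A virtual elementary embedding between structures in $V$ is an elementary embedding existing in some set-forcing extension of $V$; $\kappa$ is weakly virtually extendible if for every $\alpha>\kappa$ there are $\beta$ and a virtual elementary embedding $j:V_\alpha\to V_\beta$ with critical point $\kappa$. For languages $\tau,\tau^*$, an $\omega$-forth system from $\tau$ to $\tau^*$ is a collection $\mathcal{F}$ of renamings (kind- and arity-preserving bijections) $f:\sigma\to\sigma^*$ between finite $\sigma\subseteq\tau$ and $\sigma^*\subseteq\tau^*$, with $\emptyset\in\mathcal{F}$, such that each $f\in\mathcal{F}$ and finite $\tau_0\subseteq\tau$ admit $g\in\mathcal{F}$ extending $f$ with $\tau_0\subseteq\mathrm{dom}\,g$. Each renaming $f$ induces a translation $f_*$ of sentences. A $\tau^*$-structure $\mathcal{M}$ is an $\omega$-pseudo-model of an $\mathcal{L}(\tau)$-theory $T$ if for some such $\mathcal{F}$, $\mathcal{M}$ models $f_*``(T\cap\mathcal{L}(\mathrm{dom}\,f))$ for all $f\in\mathcal{F}$. $\kappa$ is an $\omega$-pseudo-chain compactness cardinal for $\mathcal{L}$ if every $\mathcal{L}$-theory which is an increasing union $\bigcup_{\eta<\kappa}T_\eta$ of satisfiable theories has an $\omega$-pseudo-model. *)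

(* Defs.v *)
From Stdlib Require List.
From mathcomp Require Import all_boot.

Set Implicit Arguments.
Unset Strict Implicit.
Unset Printing Implicit Defensive.

(* The universe of sets.  Separation, Replacement and Foundation are stated for
   arbitrary classes of V (second-order ZFC), so that a predicate on the
   elements of a set, or a function between two sets, is the same thing as an
   element of V. *)

Record zfc : Type := ZFC {
  carrier :> Type;
  mem : carrier -> carrier -> Prop;
  zf_ext : forall x y, (forall z, mem z x <-> mem z y) -> x = y;
  zf_foundation : well_founded mem;
  zf_pairing : forall x y, exists a, forall z, mem z a <-> z = x \/ z = y;
  zf_union : forall x, exists a, forall z,
    mem z a <-> exists2 y, mem y x & mem z y;
  zf_power : forall x, exists a, forall z,
    mem z a <-> (forall y, mem y z -> mem y x);
  zf_infinity : exists a,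
    (exists2 x, mem x a & forall y, ~ mem y x) /\
    (forall x, mem x a -> exists2 y, mem y a &
       forall z, mem z y <-> mem z x \/ z = x);
  zf_separation : forall (A : carrier -> Prop) x, exists a, forall z,
    mem z a <-> mem z x /\ A z;
  zf_replacement : forall (R : carrier -> carrier -> Prop) x,
    (forall u v w, R u v -> R u w -> v = w) ->
    exists a, forall z, mem z a <-> exists2 y, mem y x & R y z;
  zf_choice : forall x,
    (forall y, mem y x -> exists z, mem z y) ->
    (forall y y' z, mem y x -> mem y' x -> mem z y -> mem z y' -> y = y') ->
    exists c, forall y, mem y x -> exists! z, mem z y /\ mem z c
}.

Notation "x '∈' y" := (mem x y) (at level 70, no associativity).

Definition El (V : zfc) (a : V) : Type := {x : V | x ∈ a}.

Section Ordinals.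
Variable V : zfc.
Implicit Types (x y a b k : V).

Definition transitive_set x : Prop := forall y z, z ∈ y -> y ∈ x -> z ∈ x.

Definition ordinal x : Prop :=
  transitive_set x /\ forall y, y ∈ x -> transitive_set y.

Definition cardinal k : Prop :=
  ordinal k /\ forall l, l ∈ k -> ~ exists f : El l -> El k, bijective f.

Definition infinite_cardinal k : Prop :=
  cardinal k /\ forall n, ~ exists f : 'I_n -> El k, bijective f.

(* in_level a x means x ∈ V_a, where V_a is the union of the powersets of the
   V_b for b < a. *)
Inductive in_level : V -> V -> Prop :=
  InLevel a b x : b ∈ a -> (forall y, y ∈ x -> in_level b y) -> in_level a x.

Definition level a : Type := {x : V | in_level a x}.

End Ordinals.

(* Second-order logic.  A language is given by its symbols of each kind;
   constant symbols are the function symbols of arity 0. *)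

Inductive kind : Type := Rel of nat | Fun of nat.

Section Syntax.
Variable S : kind -> Type.

Inductive term : Type :=
| tvar of nat
| tapp n of S (Fun n) & ('I_n -> term).

(* First-order variables are named by a number, second-order variables by
   their arity and a number. *)
Inductive formula : Type :=
| feq of term & term
| frel n of S (Rel n) & ('I_n -> term)
| fvar n of nat & ('I_n -> term)
| fnot of formula
| fand of formula & formula
| fex1 of nat & formula
| fex2 of nat & nat & formula.

Fixpoint tfree (t : term) (i : nat) : Prop :=
  match t with
  | tvar j => i = j
  | tapp n _ ts => exists m, tfree (ts m) i
  end.

Fixpoint free1 (phi : formula) (i : nat) : Prop :=
  match phi with
  | feq t u => tfree t i \/ tfree u i
  | frel n _ ts => exists m, tfree (ts m) i
  | fvar n _ ts => exists m, tfree (ts m) i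
  | fnot phi => free1 phi i
  | fand phi psi => free1 phi i \/ free1 psi i
  | fex1 j phi => i <> j /\ free1 phi i
  | fex2 _ _ phi => free1 phi i
  end.

Fixpoint free2 (phi : formula) (X : nat * nat) : Prop :=
  match phi with
  | feq _ _ | frel _ _ _ => False
  | fvar n j _ => X = (n, j)
  | fnot phi => free2 phi X
  | fand phi psi => free2 phi X \/ free2 psi X
  | fex1 _ phi => free2 phi X
  | fex2 n j phi => X <> (n, j) /\ free2 phi X
  end.

Definition sentence (phi : formula) : Prop :=
  (forall i, ~ free1 phi i) /\ (forall X, ~ free2 phi X).

Fixpoint first_order (phi : formula) : Prop :=
  match phi with
  | feq _ _ | frel _ _ _ => True
  | fvar _ _ _ | fex2 _ _ _ => False
  | fnot phi | fex1 _ phi => first_order phi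
  | fand phi psi => first_order phi /\ first_order psi
  end.

Record structure (M : Type) : Type := Structure {
  rel_int : forall n, S (Rel n) -> ('I_n -> M) -> Prop;
  fun_int : forall n, S (Fun n) -> ('I_n -> M) -> M
}.

Section Semantics.
Variables (M : Type) (A : structure M).

Fixpoint eval (e : nat -> M) (t : term) : M :=
  match t with
  | tvar i => e i
  | tapp n s ts => fun_int A s (fun m => eval e (ts m))
  end.

Definition assignment2 : Type := forall n : nat, nat -> ('I_n -> M) -> Prop.

Fixpoint sat (e : nat -> M) (E : assignment2) (phi : formula) : Prop :=
  match phi with
  | feq t u => eval e t = eval e u
  | frel n s ts => rel_int A s (fun m => eval e (ts m))
  | fvar n j ts => E n j (fun m => eval e (ts m))
  | fnot phi => ~ sat e E phi
  | fand phi psi => sat e E phi /\ sat e E psi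
  | fex1 i phi =>
      exists e', (forall j, j <> i -> e' j = e j) /\ sat e' E phi
  | fex2 n i phi =>
      exists E' : assignment2,
        (forall m j, (m, j) <> (n, i) -> E' m j = E m j) /\ sat e E' phi
  end.

Definition holds (e : nat -> M) (phi : formula) : Prop :=
  forall E, sat e E phi.

Definition models (phi : formula) : Prop := forall e, holds e phi.

End Semantics.
End Syntax.

Section Translation.
Variables (S S' : kind -> Type) (r : forall k, S k -> S' k).

Fixpoint tmap (t : term S) : term S' :=
  match t with
  | tvar i => tvar S' i
  | tapp n s ts => tapp (r s) (fun m => tmap (ts m))
  end.

Fixpoint fmap (phi : formula S) : formula S' :=
  match phi with
  | feq t u => feq (tmap t) (tmap u)
  | frel n s ts => frel (r s) (fun m => tmap (ts m))
  | fvar n j ts => fvar j (fun m => tmap (ts m))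
  | fnot phi => fnot (fmap phi)
  | fand phi psi => fand (fmap phi) (fmap psi)
  | fex1 i phi => fex1 i (fmap phi)
  | fex2 n i phi => fex2 n i (fmap phi)
  end.

End Translation.

Section PseudoModels.
Variables S S' : kind -> Type.

Definition pmap : Type := forall k, S k -> option (S' k).

Definition empty_pmap : pmap := fun _ _ => None.

(* A renaming is encoded as a finite injective partial map; it preserves kinds
   and arities by typing, and is a bijection onto its range. *)
Definition renaming (f : pmap) : Prop :=
  (exists l : seq {k & S k},
     forall k (s : S k), f k s -> List.In (existT S k s) l) /\
  (forall k (s t : S k) (u : S' k), f k s = Some u -> f k t = Some u -> s = t).

Definition extends (g f : pmap) : Prop :=
  forall k (s : S k) (u : S' k), f k s = Some u -> g k s = Some u.

Definition omega_forth_system (F : pmap -> Prop) : Prop :=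
  [/\ forall f, F f -> renaming f,
      F empty_pmap
    & forall f (l : seq {k & S k}), F f ->
        exists g, [/\ F g, extends g f &
          forall k (s : S k), List.In (existT S k s) l -> g k s]].

Definition pdom (f : pmap) (k : kind) : Type := {s : S k | f k s}.

Definition pincl (f : pmap) (k : kind) (s : pdom f k) : S k := sval s.

Definition pval (f : pmap) (k : kind) (s : pdom f k) : S' k :=
  match f k (sval s) as o return o -> S' k with
  | Some u => fun _ => u
  | None => fun h => False_rect _ (notF h)
  end (svalP s).

Definition omega_pseudo_model
    (T : formula S -> Prop) (M : Type) (A : structure S' M) : Prop :=
  exists F, omega_forth_system F /\
    forall f, F f -> forall phi : formula (pdom f),
      T (fmap (@pincl f) phi) -> models A (fmap (@pval f) phi).

End PseudoModels.

Section Compactness.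
Variable V : zfc.

Definition language : Type := kind -> V.

Definition sym (tau : language) (k : kind) : Type := El (tau k).

Definition theory (tau : language) (T : formula (sym tau) -> Prop) : Prop :=
  forall phi, T phi -> sentence phi.

Definition satisfiable (tau : language) (T : formula (sym tau) -> Prop) : Prop :=
  exists (M : V) (A : structure (sym tau) (El M)),
    inhabited (El M) /\ forall phi, T phi -> models A phi.

Definition omega_pseudo_chain_compact (k : V) : Prop :=
  infinite_cardinal k /\
  forall (tau : language) (T : V -> formula (sym tau) -> Prop),
    (forall a, a ∈ k -> theory (T a) /\ satisfiable (T a)) ->
    (forall a b, a ∈ b -> b ∈ k -> forall phi, T a phi -> T b phi) ->
    exists (tau' : language) (M : V) (A : structure (sym tau') (El M)),
      inhabited (El M) /\
      omega_pseudo_model (fun phi => exists2 a, a ∈ k & T a phi) A.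

End Compactness.

Section Forcing.
Variables (P : Type) (le : P -> P -> Prop).

Definition preorder : Prop :=
  (forall p, le p p) /\ (forall p q r, le p q -> le q r -> le p r).

(* A statement about the extension, given by the conditions p forcing it. *)
Definition fprop : Type := P -> Prop.

Definition f_check (A : Prop) : fprop := fun _ => A.
Definition f_and (A B : fprop) : fprop := fun p => A p /\ B p.
Definition f_imp (A B : fprop) : fprop :=
  fun p => forall q, le q p -> A q -> B q.
(* Quantifiers over (the check name of) a set of the ground model *)
Definition f_all (T : Type) (A : T -> fprop) : fprop := fun p => forall x, A x p.
Definition f_ex (T : Type) (A : T -> fprop) : fprop :=
  fun p => forall q, le q p -> exists2 r, le r q & exists x, A x r.

(* A name for a subset of M × N, with M and N in the ground model: j x y c says
   that the pair of (the check name of (x, y)) and c belongs to the name.  Every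
   subset of M × N in the extension has a name of this form. *)
Definition rel_name (M N : Type) : Type := M -> N -> P -> Prop.

Definition f_in (M N : Type) (j : rel_name M N) (x : M) (y : N) : fprop :=
  fun p => forall q, le q p -> exists2 r, le r q & exists2 c, le r c & j x y c.

Section Embedding.
Variables (M N : Type) (j : rel_name M N).

Definition f_function : fprop :=
  f_and (f_all (fun x : M => f_ex (fun y : N => f_in j x y)))
        (f_all (fun x : M => f_all (fun y : N => f_all (fun z : N =>
           f_imp (f_and (f_in j x y) (f_in j x z)) (f_check (y = z)))))).

(* Formulas, finite tuples from M and N, and first-order satisfaction in M and
   N are the same in the ground model and in the extension. *)
Definition f_elementary (S : kind -> Type)
    (A : structure S M) (B : structure S N) : fprop :=
  f_all (fun phi : {phi : formula S | first_order phi} =>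
  f_all (fun e : nat -> M => f_all (fun d : nat -> N =>
    f_imp (f_all (fun i : {i | free1 (sval phi) i} =>
             f_in j (e (sval i)) (d (sval i))))
          (f_check (holds A e (sval phi) <-> holds B d (sval phi)))))).

End Embedding.
End Forcing.

Section VirtuallyExtendible.
Variable V : zfc.

Definition in_sym (k : kind) : Type :=
  match k with Rel 2 => unit | _ => Empty_set end.

Definition in_structure (M : Type) (R : M -> M -> Prop) : structure in_sym M :=
  {| rel_int := fun n =>
       match n return in_sym (Rel n) -> ('I_n -> M) -> Prop with
       | 2 => fun _ a => R (a ord0) (a ord_max)
       | _ => fun s => match s with end
       end;
     fun_int := fun n s => match s with end |}.

Definition level_structure (a : V) : structure in_sym (level a) :=
  in_structure (fun x y : level a => sval x ∈ sval y).

Definition f_critical (P : Type) (le : P -> P -> Prop) (a b : V)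
    (j : rel_name P (level a) (level b)) (k : V) : fprop P :=
  f_and
    (f_all (fun x : {x : level a | sval x ∈ k} =>
       f_ex le (fun y : {y : level b | sval y = sval (sval x)} =>
         f_in le j (sval x) (sval y))))
    (f_ex le (fun x : {x : level a | sval x = k} =>
       f_ex le (fun y : {y : level b | sval y <> k} =>
         f_in le j (sval x) (sval y)))).

Definition virtual_embedding_with_crit (a b k : V) : Prop :=
  exists (P : V) (le : El P -> El P -> Prop), preorder le /\
  exists (p : El P) (j : rel_name (El P) (level a) (level b)),
    f_and (f_function le j)
      (f_and (f_elementary le j (level_structure a) (level_structure b))
             (f_critical le j k)) p.

Definition weakly_virtually_extendible (k : V) : Prop :=
  forall a, ordinal a -> k ∈ a ->
    exists2 b, ordinal b & virtual_embedding_with_crit a b k.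

End VirtuallyExtendible.

(* Main.v *)
(* Fix alpha > kappa.  For each infinite cardinal g < kappa choose a chain of
   theories (T_a)_{a<g} witnessing that g is not compact, with models N_{g,b} of
   T_b.  Let D be a set containing V_alpha and all the N_{g,b}, take every
   relation and function on D as a symbol, add a constant c, and for a < kappa
   let T_a consist of the second-order sentences true for every value b of c
   with a <= b < kappa.  An omega-pseudo-model of the union, with forth system F,
   interprets V_alpha as a well-founded structure isomorphic to some V_beta, and
   forcing with the partial maps V_alpha -> V_beta induced by F adds an elementary
   embedding.  The constant c prevents all ordinals up to kappa from being fixed
   by all members of F.  If the least g that is moved by some f in F were below
   kappa, it would be an infinite cardinal; then g < f(g), so the pseudo-model
   contains a "g-th" model of the family (N_{g,b})_b.  It satisfies all
   translations of the T_a with a < g, since these ordinals are fixed, so it is a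
   pseudo-model of the union of the chain chosen for g: a contradiction. *)

Require Import Defs.
From Stdlib Require Eqdep_dec.
From mathcomp Require Import all_boot.
From mathcomp Require Import boolp.

Set Implicit Arguments.
Unset Strict Implicit.
Unset Printing Implicit Defensive.

(* all_boot shadows these names of Defs. *)
Local Notation ordinal := Defs.ordinal.
Local Notation frel := Defs.frel.
Local Notation pmap := Defs.pmap.

(** * Sets and ordinals *)

(** Different members of F may translate the same symbol differently, so there is no single map from
    V_alpha to V_beta to read off; this is why the embedding is only virtual. Fixing the translation
    of the few symbols that describe V_alpha, and using only extensions of it, at least gives all of
    them the same beta. The constant c is indispensable: without it D itself, with identity
    renamings, would be a pseudo-model in which nothing moves. Suppose g is moved while everything
    below it is fixed. If g were a natural number or in bijection with a smaller ordinal, this would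
    be witnessed by relations on fixed ordinals, and f(g) could not contain the extra element g. As
    g is not known in advance, one language must speak of the chains for all g at once, hence the
    symbols for all relations and functions on D. Second-order logic enters twice: well-foundedness
    and full power sets pin down V_beta, and truth of a second-order sentence in N_{g,b} becomes a
    second-order statement about the index b. *)

Lemma inj_surj_bijective (A B : Type) (f : A -> B) :
  injective f -> (forall y, exists x, f x = y) -> bijective f.
Proof.
move=> fI /choice[g gP]; exists g => // x.
by apply: fI; rewrite gP.
Qed.

Lemma val_El_inj (V : zfc) (a : V) : injective (@sval V (fun x => x ∈ a)).
Proof. by move=> [x hx] [y hy] /= e; subst y; rewrite (Prop_irrelevance hx hy). Qed.

Definition inEl (V : zfc) (a x : V) (h : x ∈ a) : El a :=
  exist (fun y => y ∈ a) x h.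

Section SetTheory.
Variable V : zfc.
Implicit Types (a b c d k x y z : V).

Lemma mem_ind (Q : V -> Prop) :
  (forall x, (forall y, y ∈ x -> Q y) -> Q x) -> forall x, Q x.
Proof. exact: (well_founded_ind (zf_foundation (z := V))). Qed.

Lemma mem_irrefl x : ~ x ∈ x.
Proof. by elim/mem_ind: x => x IH xx; apply: (IH x xx xx). Qed.

Lemma mem_asym x y : x ∈ y -> ~ y ∈ x.
Proof. by elim/mem_ind: x y => x IH y xy yx; apply: (IH y yx x yx xy). Qed.

Lemma image_set a (Q : El a -> Prop) (g : El a -> V) :
  exists s, forall z, z ∈ s <-> exists2 y, Q y & g y = z.
Proof.
have [|s sP] := @zf_replacement V
  (fun u z => exists2 y : El a, sval y = u & Q y /\ g y = z) a.
  by move=> u v w [y <- [_ <-]] [y' /val_El_inj -> [_ <-]].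
exists s => z; rewrite sP; split.
  by case=> u ua [y _ [Qy gy]]; exists y.
by case=> y Qy gy; exists (sval y); [exact: (svalP y) | exists y].
Qed.

Lemma union_bound a (g : V -> V) :
  exists d, forall x y, x ∈ a -> y ∈ g x -> y ∈ d.
Proof.
have [s sP] := image_set (fun _ : El a => True) (g \o sval).
have [d dP] := zf_union s; exists d => x y xa yg; apply/dP; exists (g x) => //.
by apply/sP; exists (inEl xa).
Qed.

Lemma union2_bound a (g : V -> V -> V) :
  exists d, forall x x' y, x ∈ a -> x' ∈ a -> y ∈ g x x' -> y ∈ d.
Proof.
have /choice[h hP] : forall x, exists d, forall x' y, x' ∈ a -> y ∈ g x x' -> y ∈ d.
  by move=> x; apply: union_bound.
have [d dP] := union_bound a h; exists d => x x' y xa xa' yg.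
exact: dP xa (hP _ _ _ xa' yg).
Qed.

Lemma binary_union a b : exists d, forall z, z ∈ d <-> z ∈ a \/ z ∈ b.
Proof.
have [p pP] := zf_pairing a b; have [d dP] := zf_union p.
exists d => z; rewrite dP; split; first by case=> y /pP[->|->]; [left|right].
by case=> zy; [exists a | exists b] => //; apply/pP; [left|right].
Qed.

Lemma singleton_set a : exists d, forall z, z ∈ d <-> z = a.
Proof.
have [p pP] := zf_pairing a a; exists p => z; rewrite pP.
by split=> [[]|] //; left.
Qed.

Lemma succ_exists x : exists s, forall z, z ∈ s <-> z ∈ x \/ z = x.
Proof.
have [p pP] := singleton_set x; have [d dP] := binary_union x p.
by exists d => z; rewrite dP pP.
Qed.

Definition osucc x : V := sval (cid (succ_exists x)).

Lemma osuccP x z : z ∈ osucc x <-> z ∈ x \/ z = x.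
Proof. exact: (svalP (cid (succ_exists x)) z). Qed.

Lemma empty_exists : exists e : V, forall z, ~ z ∈ e.
Proof. by have [a [[e _ he] _]] := zf_infinity V; exists e. Qed.

Definition num n : V := iter n osucc (sval (cid empty_exists)).

Lemma num0P z : ~ z ∈ num 0.
Proof. exact: (svalP (cid empty_exists)). Qed.

Lemma memnumP n z : z ∈ num n <-> exists2 m, m < n & z = num m.
Proof.
elim: n => [|n IH]; first by split=> [/num0P|[]].
rewrite osuccP IH; split.
  by case=> [[m mn ->]|->]; [exists m => //; apply: ltnW | exists n].
case=> m; rewrite ltnS leq_eqVlt => /orP[/eqP->|mn] ->; first by right.
by left; exists m.
Qed.

Lemma num_inj : injective num.
Proof.
move=> m n; wlog mn : m n / m <= n => [W|].
  by case/orP: (leq_total m n) => ? ?; [apply: W | symmetry; apply: W].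
move: mn; rewrite leq_eqVlt => /orP[/eqP//|mn e].
have : num m ∈ num n by apply/memnumP; exists m.
by rewrite e => /mem_irrefl.
Qed.

Lemma num_bij n : exists f : 'I_n -> El (num n), bijective f.
Proof.
have h (i : 'I_n) : num i ∈ num n by apply/memnumP; exists i => //; case: i.
exists (fun i => inEl (h i)); apply: inj_surj_bijective.
  by move=> i j [/num_inj/val_inj].
move=> [y yn]; have /memnumP[m mn e] := yn; exists (Ordinal mn).
exact/val_El_inj.
Qed.

Lemma ord_mem a x : ordinal a -> x ∈ a -> ordinal x.
Proof.
move=> [ta ha] xa; split; first exact: ha.
by move=> y yx; apply: ha; apply: ta yx xa.
Qed.

Lemma ord_trich a b : ordinal a -> ordinal b -> [\/ a ∈ b, a = b | b ∈ a].
Proof.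
elim/mem_ind: a b => a IHa b oa; elim/mem_ind: b => b IHb ob.
have [ab|nab] := EM (a ∈ b); first by constructor 1.
have [ba|nba] := EM (b ∈ a); first by constructor 3.
constructor 2; apply: zf_ext => z; split=> zh.
  case: (IHa z zh b (ord_mem oa zh) ob) => // [zb|bz]; first by subst z.
  by case: nba; apply: oa.1 bz zh.
case: (IHb z zh (ord_mem ob zh)) => // [az|az]; last by subst z.
by case: nab; apply: ob.1 az zh.
Qed.

Lemma num_ord n : ordinal (num n).
Proof.
have tr m : transitive_set (num m).
  move=> y z zy /memnumP[i im yi]; move: zy; rewrite yi => /memnumP[j ji ->].
  by apply/memnumP; exists j => //; apply: ltn_trans ji im.
by split=> // y /memnumP[m _ ->].
Qed.

Lemma ord_num_or a : ordinal a -> (exists n, a = num n) \/ forall n, num n ∈ a.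
Proof.
move=> oa; have [|ha] := EM (exists n, a = num n); [by left | right=> n].
case: (ord_trich (num_ord n) oa) => // [e|/memnumP[m _ e]]; case: ha.
  by exists n.
by exists m.
Qed.

Lemma finite_ord a n (f : 'I_n -> El a) :
  ordinal a -> bijective f -> exists m, a = num m.
Proof.
move=> oa [g fg gf]; case: (ord_num_or oa) => // h; exfalso.
pose u (i : 'I_n.+1) := g (inEl (h i)).
have uI : injective u by move=> i j /(can_inj gf)[/num_inj/val_inj].
by have := leq_card u uI; rewrite !card_ord ltnn.
Qed.

Lemma infinite_num k : infinite_cardinal k -> forall n, num n ∈ k.
Proof.
move=> [[ok _] hk]; case: (ord_num_or ok) => // -[n e].
by case: (hk n); rewrite e; apply: num_bij.
Qed.

(* Hilbert's hotel: an infinite successor ordinal is in bijection with its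
   predecessor. *)
Lemma infinite_cardinal_limit k x : infinite_cardinal k -> x ∈ k -> osucc x ∈ k.
Proof.
move=> ik xk; have [[ok ck] fk] := ik.
have os : ordinal (osucc x).
  split=> [y z zy /osuccP[yx|e]|y /osuccP[yx|->]].
  - by apply/osuccP; left; apply: (ord_mem ok xk).1 zy yx.
  - by apply/osuccP; left; rewrite -e.
  - exact: (ord_mem (ord_mem ok xk) yx).1.
  - exact: (ord_mem ok xk).1.
case: (ord_trich os ok) => // [e|/osuccP[kx|kx]]; last first.
- by case: (@mem_irrefl x); rewrite -{2}kx.
- by case: (mem_asym kx).
case: (ck x xk).
have numx n : num n ∈ x.
  have := infinite_num ik n.+1; rewrite -e => /osuccP[|xn].
    by move=> h; apply: (ord_mem ok xk).1 h; apply/memnumP; exists n.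
  by case: (fk n.+2); rewrite -e -xn; apply: (num_bij n.+2).
pose sh z := if `[< z = x >] then num 0
             else if `[< exists n, z = num n >] then osucc z else z.
have shx z : z ∈ k -> sh z ∈ x.
  move=> zk; rewrite /sh; case: asboolP => [_|nz]; first exact: numx.
  case: asboolP => [[n ->]|_]; first exact: (numx n.+1).
  by move: zk; rewrite -e => /osuccP[].
have xnum n : num n <> x by move=> en; apply: (@mem_irrefl x); rewrite -{1}en.
pose g (z : El k) : El x := inEl (shx _ (svalP z)).
have gI : injective g.
  move=> [z zk] [w wk] [] es; apply: val_El_inj => /=; move: es; rewrite /sh.
  case: (asboolP (z = x)) => [->|nz]; case: (asboolP (w = x)) => [->|nw] //.
  - case: asboolP => [[n ->] e0|hw hn]; first by have := @num_inj 0 n.+1 e0.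
    by case: hw; exists 0.
  - case: asboolP => [[n ->] e0|hw hn]; first by have := @num_inj n.+1 0 e0.
    by case: hw; exists 0.
  case: (asboolP (exists n, z = num n)) => [[n ->]|hz];
    case: asboolP => [[m ->]|hw] //.
  - by move/(@num_inj n.+1 m.+1) => [->].
  - by move=> hn; case: hw; exists n.+1.
  - by move=> hn; case: hz; exists m.+1.
have gS (y : El x) : exists u, g u = y.
  case: y => y yx; have [[[|n] yn]|hy] := EM (exists n, y = num n).
  - exists (inEl xk); apply: val_El_inj => /=; rewrite /sh.
    by case: asboolP.
  - have nk : num n ∈ k by apply: ok.1 (numx n) xk.
    exists (inEl nk); apply: val_El_inj => /=; rewrite /sh.
    case: asboolP => [/xnum//|_]; case: asboolP => [_|]; first by rewrite yn.
    by case; exists n.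
  - have yk : y ∈ k by apply: ok.1 yx xk.
    exists (inEl yk); apply: val_El_inj => /=; rewrite /sh.
    case: asboolP => [ey|_]; first by case: (@mem_irrefl x); rewrite -{1}ey.
    by case: asboolP.
have [h gh hg] := inj_surj_bijective gI gS; exists h.
by exists g.
Qed.

Lemma in_levelP a x :
  in_level a x <-> exists2 b, b ∈ a & forall y, y ∈ x -> in_level b y.
Proof.
by split=> [h|[b ba h]]; [case: h => {}a b {}x ba h; exists b | apply: InLevel ba h].
Qed.

Lemma in_level_mono a b x :
  (forall c, c ∈ a -> c ∈ b) -> in_level a x -> in_level b x.
Proof. by move=> ab /in_levelP[c ca h]; apply/in_levelP; exists c => //; apply: ab. Qed.

Lemma in_level_trans a x y :
  transitive_set a -> in_level a x -> y ∈ x -> in_level a y.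
Proof.
move=> ta /in_levelP[b ba h] yx; apply: in_level_mono (h y yx).
by move=> c cb; apply: ta cb ba.
Qed.

Lemma in_level_ord a x : ordinal a -> x ∈ a -> in_level a x.
Proof.
elim/mem_ind: a x => a IH x oa xa; apply/in_levelP; exists x => // y.
exact: (IH x xa y (ord_mem oa xa)).
Qed.

Lemma level_set a : exists s, forall x, x ∈ s <-> in_level a x.
Proof.
elim/mem_ind: a => a IH.
have /choice[g gP] : forall b, exists s, b ∈ a ->
    forall x, (forall y, y ∈ x -> in_level b y) -> x ∈ s.
  move=> b; have [/IH[s sP]|nb] := EM (b ∈ a); last by exists a.
  have [p pP] := zf_power s; exists p => _ x h; apply/pP => y yx.
  exact/sP/h.
have [d dP] := union_bound a g.
have [s sP] := zf_separation (in_level a) d.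
exists s => x; rewrite sP; split=> [[]//|h]; split=> //.
have /in_levelP[b ba hb] := h; exact: dP ba (gP _ ba _ hb).
Qed.

End SetTheory.

(** * Types that embed into sets *)

Section Small.
Variable V : zfc.

(** Languages and forcing notions have to be elements of V but are easier to build as types;
    smallness allows the replacement at the end. *)
Definition small (X : Type) : Prop :=
  exists (a : V) (f : X -> V), injective f /\ forall x, f x ∈ a.

Lemma small_El (a : V) : small (El a).
Proof. by exists a, sval; split=> [|x]; [exact: val_El_inj | exact: (svalP x)]. Qed.

Lemma small_inj (X Y : Type) (g : X -> Y) : injective g -> small Y -> small X.
Proof.
move=> gI [a [f [fI fa]]]; exists a, (f \o g); split=> [|x]; last exact: fa.
exact: inj_comp.
Qed.

Lemma small_pred (X : Type) : small X -> small (X -> Prop).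
Proof.
move=> [a [f [fI fa]]]; have [p pP] := zf_power a.
have /choice[g gP] : forall Q : X -> Prop, exists s : V,
    forall z, z ∈ s <-> z ∈ a /\ exists2 x, Q x & f x = z.
  by move=> Q; apply: zf_separation.
exists p, g; split=> [Q R e|Q]; last by apply/pP => y /gP[].
apply/funext => x; apply/propext; split=> h.
  have : f x ∈ g Q by apply/gP; split=> //; exists x.
  by rewrite e => /gP[_ [y Ry /fI<-]].
have : f x ∈ g R by apply/gP; split=> //; exists x.
by rewrite -e => /gP[_ [y Ry /fI<-]].
Qed.

(* A pair (x, y) is coded by a subset of the sum X + Y, and the sum by the sets
   {f x} and {g y, c}, where c is in neither range. *)
Lemma small_prod (X Y : Type) : small X -> small Y -> small (X * Y).
Proof.
move=> sX sY.
have sUnion : small (X + Y).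
  case: sX sY => a [f [fI fa]] [b [g [gI gb]]].
  have [pa paP] := zf_power a; have [pb pbP] := zf_power b.
  have [c cP] := binary_union a b.
  have [d dP] := binary_union c (osucc c).
  have [s sP] := zf_power d; have [t tP] := zf_power s.
  have /choice[h hP] : forall u : X + Y, exists v : V, forall z,
      z ∈ v <-> match u with inl x => z = f x | inr y => z = g y \/ z = c end.
    case=> [x|y]; first exact: singleton_set.
    by have [p pP] := zf_pairing (g y) c; exists p.
  exists s, h; split=> [u v e|u].
    have E z : z ∈ h u <-> z ∈ h v by rewrite e.
    have fc x : f x <> c.
      by move=> fx; apply: (@mem_irrefl _ c); rewrite -{1}fx; apply/cP; left.
    have gc y : g y <> c.
      by move=> gy; apply: (@mem_irrefl _ c); rewrite -{1}gy; apply/cP; right.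
    case: u v {e} E => [x|y] [x'|y'] E.
    - by have /hP/fI-> : f x ∈ h (inl x') by apply/E/hP.
    - by have /hP/esym/fc : c ∈ h (inl x) by apply/E/hP; right.
    - by have /hP/esym/fc : c ∈ h (inl x') by apply/E/hP; right.
    - by have /hP[/gI->|/gc] : g y ∈ h (inr y') by apply/E/hP; left.
  apply/sP => z /hP; case: u => [x ->|y]; first by apply/dP; left; apply/cP; left.
  case=> ->; apply/dP; first by left; apply/cP; right.
  by right; apply/osuccP; right.
pose pair_pred (p : X * Y) (u : X + Y) : Prop :=
  match u with inl x => p.1 = x | inr y => p.2 = y end.
apply: (small_inj (g := pair_pred) _ (small_pred sUnion)).
move=> [x y] [x' y'] e.
have := congr1 (@^~ (inl x)) e; have := congr1 (@^~ (inr y)) e => /=.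
by move=> ey ex; move: (erefl x) (erefl y); rewrite {1}ex {1}ey => -> ->.
Qed.

Lemma small_fun (X Y : Type) : small X -> small Y -> small (X -> Y).
Proof.
move=> sX sY.
pose graph (f : X -> Y) (p : X * Y) : Prop := f p.1 = p.2.
apply: (small_inj (g := graph) _ (small_pred (small_prod sX sY))).
move=> f g e; apply/funext => x.
by have : graph g (x, f x) by rewrite -e.
Qed.

Lemma small_ffun n (X : Type) : small X -> small ('I_n -> X).
Proof.
move=> sX; elim: n => [|n IH].
  have [a [f [fI fa]]] := sX; exists (osucc a), (fun _ => a).
  by split=> [u v _|_]; [apply/funext; case | apply/osuccP; right].
pose uncons (f : 'I_n.+1 -> X) := (f ord0, fun i => f (lift ord0 i)).
apply: (small_inj (g := uncons) _ (small_prod sX IH)) => f g [e0 eS]; apply/funext => i.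
case: (unliftP ord0 i) => [j ->|->//]; exact: (congr1 (@^~ j) eS).
Qed.

(** The injection of X need not be onto a, so there is only one cancellation; an element of X serves
    as the value of [dec] on the rest of a. *)
Lemma small_code (X : Type) : small X -> inhabited X ->
  exists (a : V) (enc : X -> El a) (dec : El a -> X), cancel enc dec.
Proof.
move=> [a [f [fI fa]]] [x0].
exists a, (fun x => inEl (fa x)).
have /choice[g gP] : forall y : El a, exists x,
    (exists x', f x' = sval y) -> f x = sval y.
  move=> y; have [[x' e]|ne] := EM (exists x', f x' = sval y); last by exists x0.
  by exists x'.
by exists g => x; apply: fI; rewrite gP //; exists x.
Qed.

End Small.

(** * Second-order formulas and relative interpretations *)

Section FreeVariables.
Variable S : kind -> Type.
Implicit Types (t : term S) (phi : formula S).

Lemma family_bound n (Q : 'I_n -> nat -> Prop) :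
  (forall m, exists k, forall i, Q m i -> i < k) ->
  exists k, forall m i, Q m i -> i < k.
Proof.
move=> /choice[g gP]; exists (\max_m g m) => m i /gP h.
exact: leq_trans h (leq_bigmax m).
Qed.

Lemma tfree_bound t : exists k, forall i, tfree t i -> i < k.
Proof.
elim: t => [j|n s ts /family_bound[k kP]]; first by exists j.+1 => i /= ->.
by exists k => i /= [m /kP].
Qed.

Lemma free1_bound phi : exists k, forall i, free1 phi i -> i < k.
Proof.
elim: phi => [t u|n s ts|n j ts|phi [k kP]|phi [k kP] psi [l lP]|j phi [k kP]
  |n j phi [k kP]] /=; last 1 [by exists k].
- have [k kP] := tfree_bound t; have [l lP] := tfree_bound u.
  by exists (maxn k l) => i [/kP|/lP] h; rewrite leq_max h ?orbT.
- have [k kP] := family_bound (fun m => tfree_bound (ts m)).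
  by exists k => i [m /kP].
- have [k kP] := family_bound (fun m => tfree_bound (ts m)).
  by exists k => i [m /kP].
- by exists k.
- by exists (maxn k l) => i [/kP|/lP] h; rewrite leq_max h ?orbT.
- by exists k => i [_ /kP].
Qed.

Lemma free2_finite phi : exists l : seq (nat * nat), forall X, free2 phi X -> X \in l.
Proof.
elim: phi => [t u|n s ts|n j ts|phi IH|phi [k kP] psi [l lP]|j phi IH
  |n j phi [k kP]] //=; try by exists [::].
- by exists [:: (n, j)] => X ->; rewrite inE.
- by exists (k ++ l) => X [/kP|/lP] h; rewrite mem_cat h ?orbT.
- by exists k => X [_ /kP].
Qed.

Lemma first_order_free2 phi : first_order phi -> forall X, ~ free2 phi X.
Proof.
elim: phi => //= [_ _ _ _ []|? ? ? _ _ []|phi IH psi IH' [f1 f2] X []] //.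
  exact: IH.
exact: IH'.
Qed.

Definition fimp phi psi := fnot (fand phi (fnot psi)).
Definition fall1 i phi := fnot (fex1 i (fnot phi)).
Definition fall2 n i phi := fnot (fex2 n i (fnot phi)).

Definition equivalent phi psi :=
  forall M (A : structure S M), models A phi <-> models A psi.

Lemma models_fall1 i phi : equivalent (fall1 i phi) phi.
Proof.
move=> M A; split=> h e E; last by move=> [e' [_]]; apply; apply: h.
by apply: contrapT => n; apply: (h e E); exists e.
Qed.

Lemma models_fall2 n i phi : equivalent (fall2 n i phi) phi.
Proof.
move=> M A; split=> h e E; last by move=> [E' [_]]; apply; apply: h.
by apply: contrapT => ns; apply: (h e E); exists E.
Qed.

(** Theories consist of sentences, whereas the statements to be transferred are written with free
    variables of both orders, over which [models] quantifies. *)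
Lemma universal_closure phi : exists2 psi, sentence psi & equivalent psi phi.
Proof.
have [k kP] := free1_bound phi.
have [psi [psiP sub eqv]] : exists psi, [/\ forall i, ~ free1 psi i,
    forall X, free2 psi X -> free2 phi X & equivalent psi phi].
  elim: k phi kP => [|k IH] phi kP; first by exists phi; split=> // i /kP.
  have [|psi [h1 h2 h3]] := IH (fall1 k phi).
    move=> i /= [ik /kP]; rewrite ltnS leq_eqVlt => /orP[/eqP|//].
    by move/ik.
  by exists psi; split=> // M A; rewrite h3; apply: models_fall1.
have [l lP] := free2_finite phi.
have {sub}lP X : free2 psi X -> X \in l by move/sub/lP.
elim: l psi psiP lP eqv => [|[n j] l IH] psi psiP lP eqv.
  by exists psi => //; split=> // X /lP.
apply: (IH (fall2 n j psi)) => // [X /= [ne /lP]|M A].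
  by rewrite inE => /orP[/eqP/ne|].
by rewrite models_fall2 eqv.
Qed.

End FreeVariables.

Section Reduct.
Variables (S S' : kind -> Type) (r : forall k, S k -> S' k).

Definition reduct M (A : structure S' M) : structure S M :=
  {| rel_int := fun n s => rel_int A (r s);
     fun_int := fun n s => fun_int A (r s) |}.

Lemma eval_tmap M (A : structure S' M) e t :
  eval A e (tmap r t) = eval (reduct A) e t.
Proof. by elim: t => //= n s ts IH; congr fun_int; apply/funext. Qed.

Lemma sat_fmap M (A : structure S' M) phi e E :
  sat A e E (fmap r phi) <-> sat (reduct A) e E phi.
Proof.
have ev e' n (ts : 'I_n -> term S) :
  (fun m => eval A e' (tmap r (ts m))) = (fun m => eval (reduct A) e' (ts m)).
  by apply/funext => m; apply: eval_tmap.
elim: phi e E => [t u|n s ts|n j ts|phi IH|phi IH psi IH'|j phi IH|n j phi IH]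
  e E /=.
- by rewrite !eval_tmap.
- by rewrite ev.
- by rewrite ev.
- by rewrite IH.
- by rewrite IH IH'.
- by split=> -[e' [h s]]; exists e'; split=> //; apply/IH.
- by split=> -[E' [h s]]; exists E'; split=> //; apply/IH.
Qed.

Lemma models_fmap M (A : structure S' M) phi :
  models A (fmap r phi) <-> models (reduct A) phi.
Proof. by split=> h e E; apply/sat_fmap/h. Qed.

Lemma tfree_tmap t i : tfree (tmap r t) i <-> tfree t i.
Proof. by elim: t => //= n s ts IH; split=> -[m /IH]; exists m. Qed.

Lemma free1_fmap phi i : free1 (fmap r phi) i <-> free1 phi i.
Proof.
elim: phi => [t u|n s ts|n j ts|phi IH|phi IH psi IH'|j phi IH|n j phi IH] /=.
- by rewrite !tfree_tmap.
- by split=> -[m /tfree_tmap]; exists m.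
- by split=> -[m /tfree_tmap]; exists m.
- by [].
- by rewrite IH IH'.
- by rewrite IH.
- by [].
Qed.

Lemma free2_fmap phi X : free2 (fmap r phi) X <-> free2 phi X.
Proof.
elim: phi => [t u|n s ts|n j ts|phi IH|phi IH psi IH'|j phi IH|n j phi IH] //=.
  by rewrite IH IH'.
by rewrite IH.
Qed.

Lemma sentence_fmap phi : sentence (fmap r phi) <-> sentence phi.
Proof.
split=> -[h1 h2]; split=> x; first [rewrite -free1_fmap | rewrite -free2_fmap
  | rewrite free1_fmap | rewrite free2_fmap]; exact: h1 || exact: h2.
Qed.

End Reduct.

Lemma fmap_comp S S' S'' (r : forall k, S k -> S' k) (r' : forall k, S' k -> S'' k)
    (phi : formula S) :
  fmap r' (fmap r phi) = fmap (fun k s => r' k (r k s)) phi.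
Proof.
have tm t : tmap r' (tmap r t) = tmap (fun k s => r' k (r k s)) t.
  by elim: t => //= n s ts IH; congr tapp; apply/funext.
elim: phi => [t u|n s ts|n j ts|phi IH|phi IH psi IH'|j phi IH|n j phi IH] /=.
- by rewrite !tm.
- by congr (frel _ _); apply/funext.
- by congr (fvar _ _); apply/funext.
- by rewrite IH.
- by rewrite IH IH'.
- by rewrite IH.
- by rewrite IH.
Qed.

Definition upd (M : Type) (e : nat -> M) (i : nat) (x : M) : nat -> M :=
  fun j => if eqn j i then x else e j.

Lemma upd_other M (e : nat -> M) i x j : j <> i -> upd e i x j = e j.
Proof. by rewrite /upd; case: eqnP. Qed.

Lemma upd_same M (e : nat -> M) i x : upd e i x i = x.
Proof. by rewrite /upd; case: eqnP. Qed.

Lemma sat_fex1 S M (A : structure S M) e E i (phi : formula S) :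
  sat A e E (fex1 i phi) <-> exists x, sat A (upd e i x) E phi.
Proof.
split=> /= [[e' [h s]]|[x s]]; last first.
  by exists (upd e i x); split=> // j; apply: upd_other.
exists (e' i); suff -> : upd e i (e' i) = e' by [].
by apply/funext => j; rewrite /upd; case: eqnP => [->|/h].
Qed.

Section VariableFormulas.

(* Formulas whose terms are variables, with more connectives than [formula], so
   that their satisfaction [vsat] unfolds to a readable proposition. *)
Variable S : kind -> Type.

Inductive vformula : Type :=
| Vform of formula S
| Veq of nat & nat
| Vrel1 of S (Rel 1) & nat
| Vrel2 of S (Rel 2) & nat & nat
| Vvar of nat
| Vnot of vformula
| Vand of vformula & vformula
| Vimp of vformula & vformula
| Viff of vformula & vformula
| Vall of nat & vformula
| Vex of nat & vformula.

Definition tup1 (T : Type) (x : T) : 'I_1 -> T := fun _ => x.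
Definition tup2 (T : Type) (x y : T) : 'I_2 -> T :=
  fun m => match nat_of_ord m with 0 => x | _ => y end.

Fixpoint vform (p : vformula) : formula S :=
  match p with
  | Vform phi => phi
  | Veq i j => feq (tvar S i) (tvar S j)
  | Vrel1 s i => frel s (tup1 (tvar S i))
  | Vrel2 s i j => frel s (tup2 (tvar S i) (tvar S j))
  | Vvar i => fvar 0 (tup1 (tvar S i))
  | Vnot p => fnot (vform p)
  | Vand p q => fand (vform p) (vform q)
  | Vimp p q => fimp (vform p) (vform q)
  | Viff p q => fand (fimp (vform p) (vform q)) (fimp (vform q) (vform p))
  | Vall i p => fall1 i (vform p)
  | Vex i p => fex1 i (vform p)
  end.

Variables (M : Type) (A : structure S M) (E : assignment2 M).

Fixpoint vsat (e : nat -> M) (p : vformula) : Prop :=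
  match p with
  | Vform phi => sat A e E phi
  | Veq i j => e i = e j
  | Vrel1 s i => rel_int A s (tup1 (e i))
  | Vrel2 s i j => rel_int A s (tup2 (e i) (e j))
  | Vvar i => E 0 (tup1 (e i))
  | Vnot p => ~ vsat e p
  | Vand p q => vsat e p /\ vsat e q
  | Vimp p q => vsat e p -> vsat e q
  | Viff p q => vsat e p <-> vsat e q
  | Vall i p => forall x, vsat (upd e i x) p
  | Vex i p => exists x, vsat (upd e i x) p
  end.

Lemma sat_fimp e phi psi :
  sat A e E (fimp phi psi) <-> (sat A e E phi -> sat A e E psi).
Proof.
split=> [h s|h [s n]]; last exact/n/h.
by apply: contrapT => n; apply: h.
Qed.

Lemma eval_tup2 e i j :
  (fun m => eval A e (tup2 (tvar S i) (tvar S j) m)) = tup2 (e i) (e j).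
Proof. by apply/funext => -[[|m] hm]. Qed.

Lemma vformP p e : sat A e E (vform p) <-> vsat e p.
Proof.
elim: p e => [phi|i j|s i|s i j|i|p IH|p IH q IH'|p IH q IH'|p IH q IH'|i p IH
  |i p IH] e //.
- by rewrite /= eval_tup2.
- by rewrite /= IH.
- by rewrite /= IH IH'.
- by rewrite [vform _]/= sat_fimp IH IH'.
- have -> : sat A e E (vform (Viff p q)) <->
    sat A e E (fimp (vform p) (vform q)) /\ sat A e E (fimp (vform q) (vform p)) by [].
  by rewrite !sat_fimp IH IH'.
- have -> : sat A e E (vform (Vall i p)) <-> ~ sat A e E (fex1 i (fnot (vform p))) by [].
  rewrite sat_fex1; split=> [h x|h [x]]; last by apply; apply/IH/h.
  by apply/IH; apply: contrapT => n; apply: h; exists x.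
- by rewrite sat_fex1 /=; split=> -[x /IH]; exists x.
Qed.

End VariableFormulas.

(** * Relative interpretation of one second-order language in another *)

Section Interpretation.
Variables (S S' : kind -> Type) (s : nat).
Variables (dom : term S' -> formula S').
Variables (rels : forall n, S (Rel n) -> ('I_n -> term S') -> formula S').
Variables (funs : forall n, S (Fun n) -> ('I_n -> term S') -> term S').

Fixpoint tinterp (t : term S) : term S' :=
  match t with
  | tvar i => tvar S' (s + i)
  | tapp n f ts => funs f (fun m => tinterp (ts m))
  end.

(** Variables are shifted by s to keep the first s of them for parameters. Only first-order
    quantifiers are relativized: a predicate on M matters only through its values on tuples from the
    image of [iota], and since [iota] is injective every predicate on N arises from one on M. *)
Fixpoint finterp (phi : formula S) : formula S' :=
  match phi with
  | feq t u => feq (tinterp t) (tinterp u)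
  | frel n r ts => rels r (fun m => tinterp (ts m))
  | fvar n j ts => fvar j (fun m => tinterp (ts m))
  | fnot phi => fnot (finterp phi)
  | fand phi psi => fand (finterp phi) (finterp psi)
  | fex1 i phi => fex1 (s + i) (fand (dom (tvar S' (s + i))) (finterp phi))
  | fex2 n i phi => fex2 n i (finterp phi)
  end.

Variables (N M : Type) (A : structure S N) (B : structure S' M).
Variables (iota : N -> M) (e0 : nat -> M).
Hypothesis iotaI : injective iota.

Definition agree (e : nat -> M) : Prop := forall i, i < s -> e i = e0 i.

Hypothesis domP : forall e E t, agree e ->
  (sat B e E (dom t) <-> exists x, iota x = eval B e t).
Hypothesis relsP : forall n (r : S (Rel n)) e E ts xs, agree e ->
  (forall m, eval B e (ts m) = iota (xs m)) ->
  (sat B e E (rels r ts) <-> rel_int A r xs).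
Hypothesis funsP : forall n (f : S (Fun n)) e ts xs, agree e ->
  (forall m, eval B e (ts m) = iota (xs m)) ->
  eval B e (funs f ts) = iota (fun_int A f xs).

Lemma eval_tinterp t e d : agree e ->
  (forall i, tfree t i -> e (s + i) = iota (d i)) ->
  eval B e (tinterp t) = iota (eval A d t).
Proof.
move=> ae; elim: t => [i|n f ts IH] h /=; first exact: h.
by apply: funsP => // m; apply: IH => i hi; apply: h; exists m.
Qed.

Lemma agree_upd e i x : agree e -> agree (upd e (s + i) x).
Proof.
move=> ae j js; rewrite upd_other; first exact: ae.
by move=> h; move: js; rewrite h ltnNge leq_addr.
Qed.

Lemma sat_finterp phi e d E G : agree e ->
  (forall i, free1 phi i -> e (s + i) = iota (d i)) ->
  (forall n j, free2 phi (n, j) -> forall xs,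
     E n j (fun m => iota (xs m)) <-> G n j xs) ->
  (sat B e E (finterp phi) <-> sat A d G phi).
Proof.
elim: phi e d E G => [t u|n r ts|n j ts|phi IH|phi IH psi IH'|i phi IH|n j phi IH]
  e d E G ae h1 h2.
- rewrite /= !(@eval_tinterp _ e d) //; first by split=> [/iotaI|->].
  + by move=> i hi; apply: h1; right.
  + by move=> i hi; apply: h1; left.
- apply: relsP => // m; apply: eval_tinterp => // i hi; apply: h1; by exists m.
- rewrite /= -h2 //=.
  have -> // : (fun m => eval B e (tinterp (ts m)))
             = (fun m => iota (eval A d (ts m))).
  apply/funext => m; apply: eval_tinterp => // i hi; apply: h1; by exists m.
- by rewrite /= (IH e d E G).
- rewrite /= (IH e d E G) ?(IH' e d E G) //.
  + by move=> i hi; apply: h1; right.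
  + by move=> n j hX; apply: h2; right.
  + by move=> i hi; apply: h1; left.
  + by move=> n j hX; apply: h2; left.
- have key x : sat B (upd e (s + i) (iota x)) E (finterp phi)
               <-> sat A (upd d i x) G phi.
    apply: IH => // [|k hk]; first exact: agree_upd.
    have [->|ne] := eqVneq k i; first by rewrite !upd_same.
    move/eqP: ne => ne; rewrite !upd_other //; first by apply: h1.
    by move/addnI.
  rewrite !sat_fex1; split=> [[y [hd hs]]|[x hx]].
    have [x xy] := (domP E _ (agree_upd i y ae)).1 hd.
    exists x; apply/key; move: xy hs => /=; rewrite upd_same => <- //.
  exists (iota x); split; last exact/key.
  by apply/domP; [exact: agree_upd | exists x; rewrite /= upd_same].
- split=> /= [[E' [hE hs]]|[G' [hG hs]]].
    pose G' : assignment2 N := fun n' j' =>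
      if (n', j') == (n, j) then fun xs => E' n' j' (fun m => iota (xs m))
      else G n' j'.
    exists G'; split=> [n' j' ne|]; first by rewrite /G'; case: eqP.
    move: hs; apply: (iffLR (IH e d E' G' ae h1 _)) => n' j' hf xs; rewrite /G'.
    by case: eqP => // ne; rewrite hE //; apply: h2; split.
  pose E' : assignment2 M := fun n' j' =>
    if (n', j') == (n, j) then
      fun ys => exists2 xs, ys = (fun m => iota (xs m)) & G' n' j' xs
    else E n' j'.
  exists E'; split=> [n' j' ne|]; first by rewrite /E'; case: eqP.
  move: hs; apply: (iffRL (IH e d E' G' ae h1 _)) => n' j' hf xs; rewrite /E'.
  case: eqP => [_|ne]; last by rewrite hG //; apply: h2; split.
  split=> [[xs' exs g]|g]; last by exists xs.
  suff -> : xs = xs' by [].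
  by apply/funext => m; apply: iotaI; have := congr1 (@^~ m) exs.
Qed.

End Interpretation.

(** * The universal structure *)

Lemma pval_Some S S' (f : pmap S S') k (s : S k) (u : S' k) (h : f k s) :
  f k s = Some u -> pval (exist (fun s => f k s) s h) = u.
Proof. by move=> e; rewrite /pval /=; move: (svalP _) => /=; rewrite e. Qed.

Definition nil0 (T : Type) : 'I_0 -> T := fun i => False_rect T (notF (ltn_ord i)).

Lemma nil0E (T : Type) (f : 'I_0 -> T) : f = @nil0 T.
Proof. by apply/funext; case. Qed.

Section Universal.
Variables (V : zfc) (kappa D : V) (tag : kind -> V).
Hypothesis kappa_inf : infinite_cardinal kappa.
Hypothesis kappaD : forall x, x ∈ kappa -> x ∈ D.
Hypothesis tag_inh : forall k, inhabited (El (tag k)).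
Let X := El D.

(* Every relation and function on D is available as a symbol, in several copies
   distinguished by a tag; the value of a function symbol may depend on the
   parameter b of the structure [universal b]. *)
Definition usym (k : kind) : Type :=
  match k with
  | Rel n => (El (tag (Rel n)) * (('I_n -> X) -> Prop))%type
  | Fun n => (El (tag (Fun n)) * (X -> ('I_n -> X) -> X))%type
  end.

Definition universal (b : X) : structure usym X :=
  {| rel_int := fun n s => s.2; fun_int := fun n s => s.2 b |}.

Lemma usym_code k : exists p : {a : V & ((usym k -> El a) * (El a -> usym k))%type},
  cancel (projT2 p).1 (projT2 p).2.
Proof.
have x0 : X := inEl (kappaD (infinite_num kappa_inf 0)).
have [t0] := tag_inh k.
have sX := small_El D.
have sk : small V (usym k).
  case: k {t0} => n; apply: small_prod; try exact: small_El.
    exact/small_pred/small_ffun.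
  by apply: small_fun => //; apply: small_fun => //; apply: small_ffun.
have [|a [enc [dec K]]] := small_code sk; last by exists (existT _ a (enc, dec)).
by case: k t0 {sk} => n t0; constructor; [exact: (t0, fun=> True) | exact: (t0, fun _ _ => x0)].
Qed.

Definition ulang : language V := fun k => projT1 (sval (cid (usym_code k))).
Definition uenc k : usym k -> sym ulang k := (projT2 (sval (cid (usym_code k)))).1.
Definition udec k : sym ulang k -> usym k := (projT2 (sval (cid (usym_code k)))).2.

Lemma uencK k : cancel (@uenc k) (@udec k).
Proof. exact: (svalP (cid (usym_code k))). Qed.

(** For ordinals, [~ sval b ∈ a] says a <= b. *)
Definition utheory (a : V) (phi : formula (sym ulang)) : Prop :=
  sentence phi /\ forall b : X, sval b ∈ kappa -> ~ sval b ∈ a ->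
    models (reduct udec (universal b)) phi.

Lemma utheory_pseudo_model : omega_pseudo_chain_compact kappa ->
  exists (tau' : language V) (M : V) (B : structure (sym tau') (El M)),
    inhabited (El M) /\
    omega_pseudo_model (fun phi => exists2 a, a ∈ kappa & utheory a phi) B.
Proof.
move=> [_ h]; apply: h => [a ak|a b ab bk phi [s h]].
  split=> [phi []//|].
  (* The parameter b = a is allowed because a is not an element of itself. *)
  exists D, (reduct udec (universal (inEl (kappaD ak)))); split=> [|phi [_ h]].
    by constructor; exact: inEl (kappaD ak).
  by apply: h => //=; apply: mem_irrefl.
split=> // x xk xb; apply: h => // xa; apply: xb.
have [[ok _] _] := kappa_inf; exact: (ord_mem ok bk).1 xa ab.
Qed.

Section Transfer.
Variables (tau' : language V) (M : V) (B : structure (sym tau') (El M)).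
Variable F : pmap (sym ulang) (sym tau') -> Prop.
Hypothesis F_model : forall f, F f -> forall phi : formula (pdom f),
  (exists2 a, a ∈ kappa & utheory a (fmap (@pincl _ _ f) phi)) ->
  models B (fmap (@pval _ _ f) phi).

Variable t0 : El (tag (Fun 0)).

(* An element of D depending on the parameter b, as a constant symbol. *)
Definition uconst (h : X -> X) : sym ulang (Fun 0) :=
  @uenc (Fun 0) (t0, fun b _ => h b).

Definition realizes (f : pmap (sym ulang) (sym tau')) (h : X -> X) (y : El M) : Prop :=
  exists w, f (Fun 0) (uconst h) = Some w /\ fun_int B w (@nil0 _) = y.

Inductive with_consts (S : kind -> Type) (n : nat) : kind -> Type :=
| Old k of S k : with_consts S n k
| New of 'I_n : with_consts S n (Fun 0).
Arguments Old {S n k}.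
Arguments New {S n}.

(** All use of the pseudo-model passes through this. The prescribed values [h i b] are named by
    constant symbols; the formula saying that phi holds whenever the first n variables equal these
    constants is true in [universal b] for all a <= b < kappa, so its universal closure belongs to
    T_a and can be translated by f. *)
Lemma transfer f S (u : forall k, S k -> usym k) (v : forall k, S k -> sym tau' k)
    n (h : nat -> X -> X) (phi : formula S) (a : V) :
  F f -> (forall k (s : S k), f k (uenc (u k s)) = Some (v k s)) -> a ∈ kappa ->
  (forall b : X, sval b ∈ kappa -> ~ sval b ∈ a -> forall e E,
     (forall i, i < n -> e i = h i b) -> sat (reduct u (universal b)) e E phi) ->
  forall e E, (forall i, i < n -> realizes f (h i) (e i)) -> sat (reduct v B) e E phi.
Proof.
move=> Ff fuv ak H e E ih.
have /choice[w wP] : forall i : 'I_n, exists w,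
    f (Fun 0) (uconst (h i)) = Some w /\ fun_int B w (@nil0 _) = e i.
  by move=> i; apply: ih.
pose eqc (i : 'I_n) := feq (tvar (with_consts S n) i) (tapp (New i) (@nil0 _)).
pose Phi := foldr (fun i => fimp (eqc i)) (fmap (fun k => @Old S n k) phi) (enum 'I_n).
have PhiP T (C : structure (with_consts S n) T) e' E' : sat C e' E' Phi <->
    ((forall i, e' (nat_of_ord i) = fun_int C (New i) (@nil0 _)) ->
     sat (reduct (fun k => @Old S n k) C) e' E' phi).
  rewrite -sat_fmap /Phi.
  have -> : (forall i : 'I_n, e' i = fun_int C (New i) (@nil0 _)) <->
            (forall i, i \in enum 'I_n -> e' i = fun_int C (New i) (@nil0 _)).
    by split=> q i; [move=> _; apply: q | apply: q; rewrite mem_enum].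
  elim: (enum 'I_n) => [|i l IH]; first by split=> [//|]; apply.
  rewrite [foldr _ _ _]/= sat_fimp IH /= [X in _ = _ _ X]nil0E; split=> [q r|q r s].
    apply: q => [|j jl]; first by apply: r; rewrite inE eqxx.
    by apply: r; rewrite inE jl orbT.
  by apply: q => j; rewrite inE => /orP[/eqP->//|/s].
have [Psi Ps PsiP] := universal_closure Phi.
pose u' k (s : with_consts S n k) : usym k :=
  match s in with_consts _ _ k return usym k with
  | Old _ s => u _ s
  | New i => (t0, fun b _ => h i b)
  end.
pose v' k (s : with_consts S n k) : sym tau' k :=
  match s in with_consts _ _ k return sym tau' k with
  | Old _ s => v _ s
  | New i => w i
  end.
have fuv' k (s : with_consts S n k) : f k (uenc (u' k s)) = Some (v' k s).
  by case: s => [{}k s|i] /=; [apply: fuv | have [] := wP i].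
have Df k s : f k (uenc (u' k s)) by rewrite fuv'.
(* [F_model] concerns formulas over the domain of f, so the symbols of Psi are moved there;
   following [wm] by [pincl] or by [pval] gives back u' and v'. *)
pose wm k (s : with_consts S n k) : pdom f k :=
  exist (fun s => f k s) (uenc (u' k s)) (Df k s).
have := F_model Ff (phi := fmap wm Psi).
rewrite !fmap_comp.
have -> : (fun k s => pval (wm k s)) = v'.
  by apply: functional_extensionality_dep => k; apply/funext => s; apply: pval_Some.
rewrite models_fmap => K.
have eu : (fun k s => udec (pincl (wm k s))) = u'.
  by apply: functional_extensionality_dep => k; apply/funext => s; apply: uencK.
have /PsiP/(_ e E)/PhiP : models (reduct v' B) Psi.
  apply: K; exists a => //; split=> [|b bk ba]; first exact/sentence_fmap.
  rewrite models_fmap; suff : models (reduct u' (universal b)) Psi by rewrite -eu.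
  by rewrite PsiP => e' E'; apply/PhiP => q; apply: H bk ba _ _ _ => i im; apply: (q (Ordinal im)).
by apply=> i /=; have [_ ->] := wP i.
Qed.

End Transfer.
End Universal.

(** * The second-order theory of a level *)

(* A characterization, up to isomorphism, of the structures (V_beta, ∈), with
   R b x for x ∈ V_b, and O for the ordinals below beta. *)
Record level_axioms (Y : Type) (U : Y -> Prop) (E R : Y -> Y -> Prop)
    (O : Y -> Prop) : Prop := LevelAxioms {
  la_dom : forall x y, E x y -> U x /\ U y;
  la_ext : forall x y, U x -> U y -> (forall z, E z x <-> E z y) -> x = y;
  la_wf : forall P : Y -> Prop,
    (forall x, (forall y, E y x -> P y) -> P x) -> forall x, P x;
  la_rank : forall b x, U b -> U x ->
    (R b x <-> exists c, E c b /\ forall y, E y x -> R c y);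
  la_full : forall (P : Y -> Prop) b, O b -> (forall x, P x -> U x /\ R b x) ->
    exists y, U y /\ forall x, E x y <-> P x;
  la_cover : forall x, U x -> exists b, O b /\ forall y, E y x -> R b y;
  la_O : forall b, O b -> U b;
  la_O_mem : forall b c, O b -> E c b -> O c;
  la_O_trans : forall b c d, O b -> E c b -> E d c -> E d b
}.

Section LevelFormula.

Inductive level_sym : kind -> Type :=
| LU : level_sym (Rel 1)
| LE : level_sym (Rel 2)
| LR : level_sym (Rel 2)
| LO : level_sym (Rel 1).

Let E i j := Vrel2 LE i j.
Let R i j := Vrel2 LR i j.
Let U i := Vrel1 LU i.
Let O i := Vrel1 LO i.
Let P i := Vvar level_sym i.

(** The predicate P of [la_wf] and [la_full] is a free second-order variable, so it is quantified
    universally by [models]. *)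
Definition level_formula : vformula level_sym :=
  Vand (Vall 0 (Vall 1 (Vimp (E 0 1) (Vand (U 0) (U 1)))))
  (Vand (Vall 0 (Vall 1 (Vimp (U 0) (Vimp (U 1)
           (Vimp (Vall 2 (Viff (E 2 0) (E 2 1))) (Veq _ 0 1))))))
  (Vand (Vimp (Vall 0 (Vimp (Vall 1 (Vimp (E 1 0) (P 1))) (P 0))) (Vall 0 (P 0)))
  (Vand (Vall 0 (Vall 1 (Vimp (U 0) (Vimp (U 1)
           (Viff (R 0 1) (Vex 2 (Vand (E 2 0) (Vall 3 (Vimp (E 3 1) (R 2 3))))))))))
  (Vand (Vall 0 (Vimp (O 0) (Vimp (Vall 1 (Vimp (P 1) (Vand (U 1) (R 0 1))))
           (Vex 2 (Vand (U 2) (Vall 1 (Viff (E 1 2) (P 1))))))))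
  (Vand (Vall 0 (Vimp (U 0) (Vex 1 (Vand (O 1) (Vall 2 (Vimp (E 2 0) (R 1 2)))))))
  (Vand (Vall 0 (Vimp (O 0) (U 0)))
  (Vand (Vall 0 (Vall 1 (Vimp (O 0) (Vimp (E 1 0) (O 1)))))
        (Vall 0 (Vall 1 (Vall 2 (Vimp (O 0) (Vimp (E 1 0) (Vimp (E 2 1) (E 2 0)))))))))))))).

Lemma level_formulaP Y (C : structure level_sym Y) : inhabited Y ->
  models C (vform level_formula) <->
  level_axioms (fun x => rel_int C LU (tup1 x))
    (fun x y => rel_int C LE (tup2 x y)) (fun x y => rel_int C LR (tup2 x y))
    (fun x => rel_int C LO (tup1 x)).
Proof.
move=> [y0]; split=> [h|[h1 h2 h3 h4 h5 h6 h7 h8 h9] e G].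
  pose asg (Q : Y -> Prop) : assignment2 Y := fun n _ =>
    match n with 1 => fun xs => Q (xs ord0) | _ => fun=> True end.
  have {}h Q := (vformP C (asg Q) level_formula (fun=> y0)).1 (h _ _).
  have [h1 [h2 [_ [h4 [_ [h6 [h7 [h8 h9]]]]]]]] := h (fun=> True).
  split.
  - exact: h1.
  - exact: h2.
  - by move=> Q; have [_ [_ [h3 _]]] := h Q; apply: h3.
  - exact: h4.
  - by move=> Q; have [_ [_ [_ [_ [h5 _]]]]] := h Q; apply: h5.
  - exact: h6.
  - exact: h7.
  - exact: h8.
  - exact: h9.
apply/vformP; split; first exact: h1.
split; first exact: h2.
split; first exact: (h3 (fun x => G 1 0 (tup1 x))).
split; first exact: h4.
split; first by move=> b; apply: (h5 (fun x => G 1 0 (tup1 x))).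
by [].
Qed.

End LevelFormula.

Section Collapse.
Variables (V : zfc) (M : V) (U O : El M -> Prop) (E R : El M -> El M -> Prop).
Hypothesis ax : level_axioms U E R O.

Lemma collapse_exists :
  exists p : El M -> V, forall y z, z ∈ p y <-> exists2 x, E x y & p x = z.
Proof.
have wfE : well_founded E by apply: (la_wf ax) => x h; constructor.
(* [image_set] wants a total function but [rec] is defined on predecessors of y only; [sval x] is a
   filler, and the image is taken over predecessors alone. *)
pose step y (rec : forall x, E x y -> V) : V :=
  sval (cid (image_set (fun x : El M => E x y)
    (fun x => match pselect (E x y) with left h => rec x h | right _ => sval x end))).
have stepP y (rec : forall x, E x y -> V) z :
    z ∈ step y rec <-> exists x (h : E x y), rec x h = z.
  rewrite (svalP (cid (image_set _ _)) z).
  split=> [[x xy]|[x [h e]]]; first by case: pselect => // h e; exists x, h.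
  by exists x => //; case: pselect => // h'; rewrite (Prop_irrelevance h' h).
exists (Fix wfE (fun=> V) step) => y z.
rewrite Fix_eq; last first.
  move=> x f g fg; congr step; apply: functional_extensionality_dep => w.
  by apply: functional_extensionality_dep.
by rewrite stepP; split=> [[x [h e]]|[x h e]]; exists x => //; exists h.
Qed.

(** Here p is the Mostowski collapse and beta is the image of O. Since R becomes membership in
    levels, [la_cover] puts the image of U inside V_beta. Conversely, if the elements of z are
    already values of p on U and lie in a common level, [la_full] collects their preimages into a
    preimage of z. *)
Lemma collapse_level : exists (beta : V) (p : El M -> V),
  [/\ ordinal beta,
      forall y z, z ∈ p y <-> exists2 x, E x y & p x = z,
      forall x y, U x -> U y -> p x = p y -> x = y,
      forall b, O b -> p b ∈ beta
    & forall z, in_level beta z <-> exists2 x, U x & p x = z].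
Proof.
have [p pP] := collapse_exists.
have [beta betaP] := image_set O p.
have obeta : ordinal beta.
  have mem_beta b c : O b -> c ∈ p b -> exists2 d, O d & p d = c.
    by move=> Ob /pP[d db <-]; exists d => //; apply: (la_O_mem ax) Ob db.
  split=> [y z zy /betaP[b Ob e]|y /betaP[b Ob <-] z w wz zb].
    by apply/betaP/(mem_beta b) => //; rewrite e.
  have /pP[c cb e] := zb; move: wz; rewrite -e => /pP[d dc ed].
  by apply/pP; exists d => //; apply: (la_O_trans ax) Ob cb dc.
have pI x y : U x -> U y -> p x = p y -> x = y.
  move: x y; apply: (la_wf ax) => x IH y Ux Uy exy.
  apply: (la_ext ax) => // z; split=> zh.
    have : p z ∈ p y by rewrite -exy; apply/pP; exists z.
    move=> /pP[w wy ewz]; have [Uz _] := la_dom ax zh; have [Uw _] := la_dom ax wy.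
    by rewrite (IH z zh w).
  have : p z ∈ p x by rewrite exy; apply/pP; exists z.
  move=> /pP[w wx ewz]; have [Uz _] := la_dom ax zh; have [Uw _] := la_dom ax wx.
  by rewrite -(IH w wx z).
have RP b x : U b -> U x -> (R b x <-> in_level (p b) (p x)).
  move: b x; apply: (la_wf ax) => b IH x Ub Ux.
  rewrite (la_rank ax Ub Ux) in_levelP; split=> [[c [cb h]]|[z /pP[c cb <-] h]].
    exists (p c); first by apply/pP; exists c.
    move=> y /pP[w wx <-]; have [Uc _] := la_dom ax cb.
    by apply/IH => //; [have [] := la_dom ax wx | apply: h].
  exists c; split=> // y yx; have [Uc _] := la_dom ax cb.
  by apply/IH => //; [have [] := la_dom ax yx | apply/h/pP; exists y].
exists beta, p; split=> // [b Ob|z]; first by apply/betaP; exists b.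
split=> [|[x Ux <-]]; last first.
  have [b [Ob h]] := la_cover ax Ux; apply/in_levelP; exists (p b).
    by apply/betaP; exists b.
  move=> _ /pP[y yx <-]; apply/RP; [exact: (la_O ax Ob) | | exact: h].
  by have [] := la_dom ax yx.
elim/mem_ind: z => z IH /in_levelP[z' /betaP[b Ob <-] h].
have hU y : y ∈ z -> exists2 x, U x & p x = y.
  move=> yz; apply: IH => //; apply: in_level_mono (h y yz) => c cb.
  by apply: obeta.1 cb _; apply/betaP; exists b.
have [|y [Uy yP]] := la_full ax (P := fun x => U x /\ p x ∈ z) Ob.
  by move=> x [Ux xz]; split=> //; apply/RP => //; [exact: (la_O ax Ob) | apply: h].
exists y => //; apply: zf_ext => w; rewrite pP; split=> [[x /yP[_ xz] <-]//|wz].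
by have [x Ux e] := hU w wz; exists x => //; apply/yP; rewrite e.
Qed.

End Collapse.

Lemma level_axioms_level (V : zfc) (D alpha : V) :
  ordinal alpha -> (forall x, in_level alpha x -> x ∈ D) ->
  level_axioms (fun x : El D => in_level alpha (sval x))
    (fun x y => [/\ in_level alpha (sval x), in_level alpha (sval y)
                  & sval x ∈ sval y])
    (fun x y => in_level (sval x) (sval y)) (fun x => sval x ∈ alpha).
Proof.
move=> oa aD.
have down x y : in_level alpha x -> y ∈ x -> in_level alpha y.
  by apply: in_level_trans; case: oa.
have elD x : in_level alpha x -> exists x' : El D, sval x' = x.
  by move=> /aD h; exists (inEl h).
split.
- by move=> x y [].
- move=> x y ax ay h; apply: val_El_inj; apply: zf_ext => z.
  split=> zh; have az := down _ _ _ zh.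
    have [z' ez] := elD z (az ax).
    by have [|_ _] := (h z').1; rewrite ?ez //; split=> //; apply: az.
  have [z' ez] := elD z (az ay).
  by have [|_ _] := (h z').2; rewrite ?ez //; split=> //; apply: az.
- move=> P h x; case: x => x xD.
  elim/mem_ind: x xD => x IH xD; apply: h => -[y yD] [_ _ /= yx].
  exact: IH.
- move=> b x ab ax; rewrite in_levelP; split=> [[c cb h]|[c [[_ _ cb] h]]].
    have [c' ec] := elD c (down _ _ ab cb); exists c'; rewrite ec.
    by split=> [|y [_ _ yx]]; [split=> //; apply: down ab cb | apply: h].
  exists (sval c) => // y yx; have [y' ey] := elD y (down _ _ ax yx).
  by rewrite -ey; apply: h; rewrite ey; split=> //; apply: down ax yx.
- move=> P b ba h.
  have [s sP] := zf_separation (fun z => exists2 x : El D, sval x = z & P x) D.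
  have sb y : y ∈ s -> in_level (sval b) y.
    by move=> /sP[_ [x <- /h[]]].
  have as_ : in_level alpha s by apply/in_levelP; exists (sval b).
  have [s' es] := elD s as_; exists s'; rewrite es; split=> // x; split.
    by case=> _ _ /sP[_ [x' /val_El_inj<-]].
  move=> Px; split=> //; first by have [] := h x Px.
  by apply/sP; split; [exact: (svalP x) | exists x].
- move=> x /in_levelP[b ba h]; have [b' eb] := elD b (in_level_ord oa ba).
  by exists b'; rewrite eb; split=> // y [_ _]; apply: h.
- by move=> b; apply: in_level_ord.
- by move=> b c ba [_ _ cb]; apply: oa.1 cb ba.
- move=> b c d ba [_ ab cb] [ad _ dc]; split=> //.
  exact: (ord_mem oa ba).1 dc cb.
Qed.

(** * Chains of theories below kappa *)

Section Chains.
Variable V : zfc.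

(** The models form a total family on V, constrained only at indices in g, so that no membership
    proof enters their types. *)
Record chain (g : V) : Type := Chain {
  ctau : language V;
  cthy : V -> formula (sym ctau) -> Prop;
  cdom : V -> V;
  cstr : forall b, structure (sym ctau) (El (cdom b));
  cdom_inh : forall b, inhabited (El (cdom b));
  cthy_mono : forall a b, a ∈ b -> b ∈ g -> forall phi, cthy a phi -> cthy b phi;
  cthy_sentence : forall a, a ∈ g -> theory (cthy a);
  cstr_models : forall a, a ∈ g -> forall phi, cthy a phi -> models (cstr a) phi
}.

Arguments ctau {g} c.
Arguments cthy {g} c.
Arguments cdom {g} c.
Arguments cstr {g} c b.
Arguments cdom_inh {g} c.
Arguments cthy_mono {g} c {a b}.
Arguments cthy_sentence {g} c {a}.
Arguments cstr_models {g} c {a}.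

Definition chain_has_pseudo_model g (C : chain g) : Prop :=
  exists (tau' : language V) (M : V) (A : structure (sym tau') (El M)),
    inhabited (El M) /\
    omega_pseudo_model (fun phi => exists2 a, a ∈ g & cthy C a phi) A.

Lemma exists_model (tau : language V) (T : formula (sym tau) -> Prop) :
  exists p : {M : V & structure (sym tau) (El M)}, inhabited (El (projT1 p)) /\
    (satisfiable T -> forall phi, T phi -> models (projT2 p) phi).
Proof.
have [[M [A [i h]]]|n] := EM (satisfiable T); first by exists (existT _ M A).
have [s sP] := singleton_set (num V 0).
have x : El s by apply: (@inEl V s (num V 0)); apply/sP.
by exists (existT _ s (Structure (fun _ _ _ => True) (fun _ _ _ => x))).
Qed.

Lemma not_compact_chain g : infinite_cardinal g -> ~ omega_pseudo_chain_compact g ->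
  exists C : chain g, ~ chain_has_pseudo_model C.
Proof.
move=> ig nc; apply: contrapT => nC; apply: nc; split=> // tau T Tsat Tmono.
apply: contrapT => np; apply: nC.
have /choice[p pP] := fun a => exists_model (T a).
exists (@Chain g tau T (fun a => projT1 (p a)) (fun a => projT2 (p a))
  (fun b => (pP b).1) Tmono (fun a ag => (Tsat a ag).1)
  (fun a ag => (pP a).2 (Tsat a ag).2)) => h; exact: np.
Qed.

Lemma chain_inhabited g : inhabited (chain g).
Proof.
have [s sP] := singleton_set (num V 0).
have x : El s by apply: (@inEl V s (num V 0)); apply/sP.
constructor; apply: (@Chain g (fun=> s) (fun _ _ => False) (fun=> s)
  (fun=> Structure (fun _ _ _ => True) (fun _ _ _ => x))) => //.
Qed.

Lemma witness_chains : exists C : forall g, chain g, forall g,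
  infinite_cardinal g -> ~ omega_pseudo_chain_compact g ->
  ~ chain_has_pseudo_model (C g).
Proof.
have h g : exists C : chain g, infinite_cardinal g ->
    ~ omega_pseudo_chain_compact g -> ~ chain_has_pseudo_model C.
  have [ig|] := EM (infinite_cardinal g); last by have [C] := chain_inhabited g; exists C.
  have [|nc] := EM (omega_pseudo_chain_compact g).
    by have [C] := chain_inhabited g; exists C.
  by have [C CP] := not_compact_chain ig nc; exists C.
by exists (fun g => sval (cid (h g))) => g; apply: (svalP (cid (h g))).
Qed.

End Chains.

Arguments ctau {V g} c.
Arguments cthy {V g} c.
Arguments cdom {V g} c.
Arguments cstr {V g} c b.
Arguments cdom_inh {V g} c.
Arguments cthy_mono {V g} c {a b}.
Arguments cthy_sentence {V g} c {a}.
Arguments cstr_models {V g} c {a}.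

Lemma seq_preimage (A B : Type) (f : A -> B) (l : seq B) : injective f ->
  exists l' : seq A, forall a, List.In (f a) l -> List.In a l'.
Proof.
move=> fI; elim: l => [|b l [l' h]]; first by exists [::].
have [[a ab]|nb] := EM (exists a, f a = b); last first.
  by exists l' => a /= [e|/h//]; case: nb; exists a.
by exists (a :: l') => a' /= [e|/h]; [left; apply: fI; rewrite ab | right].
Qed.

(** * Indexed families of models inside one structure *)

Definition scons (T : Type) (x : T) n (f : 'I_n -> T) : 'I_n.+1 -> T :=
  fun i => oapp f x (unlift ord0 i).

Lemma scons0 T (x : T) n (f : 'I_n -> T) : scons x f ord0 = x.
Proof. by rewrite /scons unlift_none. Qed.

Lemma sconsS T (x : T) n (f : 'I_n -> T) i : scons x f (lift ord0 i) = f i.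
Proof. by rewrite /scons liftK. Qed.

Lemma scons_map T T' (g : T -> T') (x : T) n (f : 'I_n -> T) :
  (fun m => g (scons x f m)) = scons (g x) (fun m => g (f m)).
Proof. by apply/funext => m; rewrite /scons; case: (unlift _ _). Qed.

(** The additional first argument is the index of the model in which the symbol is evaluated. *)
Definition up (k : kind) : kind :=
  match k with Rel n => Rel n.+1 | Fun n => Fun n.+1 end.
Definition down (k : kind) : kind :=
  match k with Rel n => Rel n.-1 | Fun n => Fun n.-1 end.

Lemma up_inj : injective up.
Proof. by case=> n [m|m] //= [->]. Qed.

(* E(v, x) orders the indices, D(v, x) says that x lies in the v-th model. *)
Inductive family_sym (S : kind -> Type) : kind -> Type :=
| XE : family_sym S (Rel 2)
| XD : family_sym S (Rel 2)
| XS k of S k : family_sym S (up k).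
Arguments XE {S}.
Arguments XD {S}.
Arguments XS {S k}.

Section FamilyInterpretation.
Variable S : kind -> Type.

(* In this interpretation the variable 2 holds the index of the model; the
   variables 0 and 1 are left free for parameters. *)
Definition fam_dom (t : term (family_sym S)) : formula (family_sym S) :=
  frel XD (tup2 (tvar _ 2) t).
Definition fam_rel n (r : S (Rel n)) (ts : 'I_n -> term (family_sym S)) :=
  @Defs.frel (family_sym S) n.+1 (XS r) (scons (tvar _ 2) ts).
Definition fam_fun n (r : S (Fun n)) (ts : 'I_n -> term (family_sym S)) :=
  @tapp (family_sym S) n.+1 (XS r) (scons (tvar _ 2) ts).

Lemma eval_fam_dom M (B : structure (family_sym S) M) e t :
  (fun m => eval B e (tup2 (tvar _ 2) t m)) = tup2 (e 2) (eval B e t).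
Proof. by apply/funext => -[[|m] hm]. Qed.

Lemma sat_fam_interp (N Y : Type) (A : structure S N) (B : structure (family_sym S) Y)
    (iota : N -> Y) (e0 : nat -> Y) :
  injective iota ->
  (forall x, rel_int B XD (tup2 (e0 2) x) <-> exists y, iota y = x) ->
  (forall n (r : S (Rel n)) xs,
     @rel_int _ _ B n.+1 (XS r) (scons (e0 2) (fun m => iota (xs m)))
     <-> rel_int A r xs) ->
  (forall n (r : S (Fun n)) xs,
     @fun_int _ _ B n.+1 (XS r) (scons (e0 2) (fun m => iota (xs m)))
     = iota (fun_int A r xs)) ->
  forall phi d E G, sentence phi ->
    sat B e0 E (finterp 3 fam_dom fam_rel fam_fun phi) <-> sat A d G phi.
Proof.
move=> iI hD hR hF phi d E G [s1 s2].
have ec e n (ts : 'I_n -> term (family_sym S)) xs :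
    agree 3 e0 e -> (forall m, eval B e (ts m) = iota (xs m)) ->
    (fun m => eval B e (scons (tvar _ 2) ts m))
    = scons (e0 2) (fun m => iota (xs m)).
  move=> ae h; rewrite scons_map /= ae //; congr scons; exact/funext.
apply: (sat_finterp (e0 := e0) iI) => //.
- by move=> e E' t ae /=; rewrite eval_fam_dom ae.
- by move=> n r e E' ts xs ae h /=; rewrite (ec _ _ _ _ ae h).
- by move=> n r e ts xs ae h /=; rewrite (ec _ _ _ _ ae h).
- by move=> i /s1.
- by move=> n j /s2.
Qed.

End FamilyInterpretation.

(** * A pseudo-model of a shorter chain from a new index *)

Section Descent.
Variables (V : zfc) (kappa D : V) (tag : kind -> V).
Hypothesis kappa_inf : infinite_cardinal kappa.
Hypothesis kappaD : forall x, x ∈ kappa -> x ∈ D.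
Hypothesis tag_inh : forall k, inhabited (El (tag k)).
Let X := El D.
Local Notation ulang := (ulang kappa_inf kappaD tag_inh).
Local Notation uenc := (@uenc V kappa D tag kappa_inf kappaD tag_inh _).
Local Notation utheory := (@utheory V kappa D tag kappa_inf kappaD tag_inh).

Variables (g : V) (C : chain g).
Hypothesis gk : g ∈ kappa.
Hypothesis cdomD : forall b x, b ∈ kappa -> x ∈ cdom C b -> x ∈ D.
Hypothesis ctauT : forall k s, s ∈ ctau C k -> s ∈ tag (up k).

Definition fam_relP n (s : sym (ctau C) (Rel n)) (v : X) (zs : 'I_n -> X) : Prop :=
  exists2 ys, (forall i, sval (ys i) = sval (zs i)) & rel_int (cstr C (sval v)) s ys.

(** Even when the arguments lie outside the v-th model, the value is chosen inside it. Closure under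
    the function is then a statement without hypotheses on the arguments, ready to be
    transferred. *)
Lemma fam_funP n (s : sym (ctau C) (Fun n)) (v : X) (zs : 'I_n -> X) :
  exists y : X, sval v ∈ kappa -> sval y ∈ cdom C (sval v) /\
    forall ys, (forall i, sval (ys i) = sval (zs i)) ->
      sval y = sval (fun_int (cstr C (sval v)) s ys).
Proof.
have [vk|] := EM (sval v ∈ kappa); last by exists v.
have [[ys h]|n0] := EM (exists ys : 'I_n -> El (cdom C (sval v)),
    forall i, sval (ys i) = sval (zs i)); last first.
  have [[y yN]] := cdom_inh C (sval v); exists (inEl (cdomD vk yN)) => _.
  by split=> // ys h; case: n0; exists ys.
exists (inEl (cdomD vk (svalP (fun_int (cstr C (sval v)) s ys)))) => _.
split=> [|ys' h'].
  exact: (svalP (fun_int (cstr C (sval v)) s ys)).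
have -> // : ys' = ys.
by apply/funext => i; apply: val_El_inj; rewrite h h'.
Qed.

(** Two symbols of the chain may have the same interpretation in all models. Using s as its own tag
    keeps them apart, which the injectivity of renamings requires. *)
Definition ctag k (s : sym (ctau C) k) : El (tag (up k)) := inEl (ctauT (svalP s)).

Definition fam_usym k : sym (ctau C) k -> usym D tag (up k) :=
  match k return sym (ctau C) k -> usym D tag (up k) with
  | Rel n => fun s => (ctag s,
      fun xs : 'I_n.+1 -> X => fam_relP s (xs ord0) (fun i => xs (lift ord0 i)))
  | Fun n => fun s => (ctag s, fun _ (xs : 'I_n.+1 -> X) =>
      sval (cid (fam_funP s (xs ord0) (fun i => xs (lift ord0 i)))))
  end.

Lemma fam_usym_inj k : injective (@fam_usym k).
Proof.
by case: k => n s t /(congr1 fst)/(congr1 sval) e; apply: val_El_inj.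
Qed.

Variables (tau' : language V) (M : V) (B : structure (sym tau') (El M)).
Variable F : pmap (sym ulang) (sym tau') -> Prop.
Hypothesis F_forth : omega_forth_system F.
Hypothesis F_model : forall f, F f -> forall phi : formula (pdom f),
  (exists2 a, a ∈ kappa & utheory a (fmap (@pincl _ _ f) phi)) ->
  models B (fmap (@pval _ _ f) phi).
Variable t0 : El (tag (Fun 0)).
Local Notation realizes := (@realizes V kappa D tag kappa_inf kappaD tag_inh tau' M B t0).

Variables (sE : usym D tag (Rel 2)) (wE wD : sym tau' (Rel 2)).
Variables (tD : El (tag (Rel 2))).
Definition sD : usym D tag (Rel 2) :=
  (tD, fun xs : 'I_2 -> X => sval (xs ord_max) ∈ cdom C (sval (xs ord0))).

Variable f0 : pmap (sym ulang) (sym tau').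
Hypothesis f0E : f0 (uenc sE) = Some wE.
Hypothesis f0D : f0 (uenc sD) = Some wD.
(** In the application [y0] collapses to g itself: an index below the image [yg] of g, yet below the
    image of no a < g. *)
Variables (g' : X) (yg y0 : El M).
Hypothesis f0g : realizes f0 (fun=> g') yg.
Hypothesis y0g : rel_int B wE (tup2 y0 yg).
Hypothesis y0_large : forall f a y, F f -> extends f f0 -> sval a ∈ g ->
  realizes f (fun=> a) y -> ~ rel_int B wE (tup2 y0 y).
Hypothesis sEg : forall x, sE.2 (tup2 x g') -> sval x ∈ g.
Hypothesis sE_mem : forall x a, sval a ∈ g -> sval x ∈ sval a -> sE.2 (tup2 x a).

Definition shifted : language V := fun k => tau' (up k).

Definition restrictions (f' : pmap (sym (ctau C)) (sym shifted)) : Prop :=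
  exists f, [/\ F f, extends f f0 &
    forall k (s : sym (ctau C) k) w, f' k s = Some w -> f (up k) (uenc (fam_usym s)) = Some w].

Lemma restrictions_forth : (exists2 f, F f & extends f f0) ->
  omega_forth_system restrictions.
Proof.
have [Fr _ Fx] := F_forth.
have sigI : injective (fun p : {k & sym (ctau C) k} =>
    existT (sym ulang) (up (projT1 p)) (uenc (fam_usym (projT2 p)))).
  move=> [k s] [k' s'] /= e.
  have ek : k = k' by apply: up_inj; exact: (congr1 (@projT1 _ _) e).
  subst k'; have := Eqdep_dec.inj_pair2_eq_dec _ (fun x y => pselect (x = y)) _ _ _ _ e.
  by move/(can_inj (@uencK _ _ _ _ _ _ _ _))/fam_usym_inj ->.
move=> [f1 Ff1 ef1]; split.
- move=> f' [f [Ff ef h]]; have [[l lP] fI] := Fr f Ff; split.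
    have [l' l'P] := seq_preimage l sigI.
    exists l' => k s; case e: (f' k s) => [w|] // _; apply: l'P; apply: lP.
    by rewrite (h _ _ _ e).
  move=> k s t w /h hs /h ht.
  have e := fI (up k) _ _ w hs ht.
  apply: fam_usym_inj; exact: can_inj (@uencK _ _ _ _ _ _ _ _) _ _ e.
- by exists f1; split.
- move=> f' l [f [Ff ef h]].
  have [f2 [Ff2 ef2 d2]] := Fx f (List.map (fun p : {k & sym (ctau C) k} =>
    existT (sym ulang) (up (projT1 p)) (uenc (fam_usym (projT2 p)))) l) Ff.
  exists (fun k s => f2 (up k) (uenc (fam_usym s))); split.
  + by exists f2; split=> // k s w /ef/ef2.
  + by move=> k s w /h/ef2.
  + move=> k s sl; apply: d2.
    exact: (List.in_map (fun p : {k & sym (ctau C) k} => _) _ _ sl).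
Qed.

Lemma realizes_extends f f' h y : extends f' f -> realizes f h y -> realizes f' h y.
Proof. by move=> ff' [w [e <-]]; exists w; split=> //; apply: ff'. Qed.

Definition fam_u S (q : forall k, S k -> sym (ctau C) k) k (s : family_sym S k) :
    usym D tag k :=
  match s in family_sym _ k return usym D tag k with
  | XE => sE | XD => sD | XS k s => fam_usym (q k s)
  end.

Definition fam_v S (r : forall k, S k -> sym tau' (up k)) k (s : family_sym S k) :
    sym tau' k :=
  match s in family_sym _ k return sym tau' k with
  | XE => wE | XD => wD | XS k s => r k s
  end.

(** The restriction to indices in g becomes the premise [Vrel2 XE 2 0], with g in variable 0. The
    statements hold for every value of c, so they already belong to T_0. *)
Lemma fam_transfer f S (q : forall k, S k -> sym (ctau C) k)
    (r : forall k, S k -> sym tau' (up k)) n (h : nat -> X -> X)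
    (phi : formula (family_sym S)) :
  F f -> extends f f0 ->
  (forall k (s : S k), f (up k) (uenc (fam_usym (q k s))) = Some (r k s)) ->
  h 0 = (fun=> g') -> 0 < n ->
  (forall b e E, (forall i, i < n -> e i = h i b) -> sval (e 2) ∈ g ->
     sat (reduct (fam_u q) (universal tag b)) e E phi) ->
  forall e E, (forall i, i < n -> realizes f (h i) (e i)) -> e 0 = yg -> e 2 = y0 ->
    sat (reduct (fam_v r) B) e E phi.
Proof.
move=> Ff ff0 qr h0 n0 H e E ih e0 e2.
have fuv k (s : family_sym S k) : f k (uenc (fam_u q s)) = Some (fam_v r s).
  by case: s => [||{}k s] //=; apply: ff0.
suff /vformP : sat (reduct (fam_v r) B) e E (vform (Vimp (Vrel2 XE 2 0) (Vform phi))).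
  by apply; rewrite /= e0 e2.
apply: (@transfer V kappa D tag kappa_inf kappaD tag_inh tau' M B F F_model t0
  f _ (fam_u q) (fam_v r) n h _ (num V 0)) => //; first exact: infinite_num.
move=> b _ _ e' E' ih'; apply/vformP => /= e20; apply: (H _ _ _ ih').
by apply: sEg; move: e20; rewrite (ih' 0 n0) h0.
Qed.

Lemma descent : (exists2 f, F f & extends f f0) -> chain_has_pseudo_model C.
Proof.
move=> F1.
have [N NP] := zf_separation
  (fun z => exists h : z ∈ M, rel_int B wD (tup2 y0 (inEl h))) M.
pose iota (y : El N) : El M := inEl ((NP _).1 (svalP y)).1.
have iI : injective iota by move=> x y /(congr1 sval) e; apply: val_El_inj.
have iP x : rel_int B wD (tup2 y0 x) <-> exists y, iota y = x.
  split=> [h|[y <-]]; last first.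
    have [_ [yM h]] := (NP _).1 (svalP y).
    by have -> : iota y = inEl yM by apply: val_El_inj.
  have xN : sval x ∈ N.
    apply/NP; split; first exact: (svalP x).
    by exists (svalP x); have -> : inEl (svalP x) = x by apply: val_El_inj.
  by exists (inEl xN); apply: val_El_inj.
have ok : ordinal kappa by case: kappa_inf => -[].
(* That each model of the family is nonempty is expressed with [XE] and [XD] alone. *)
pose noS (k : kind) : Type := Empty_set.
have [n0 _] : exists n0 : El N, True.
  have [f Ff ff0] := F1.
  suff /vformP[y /iP[z _]] :
      sat (reduct (fam_v (fun k (s : noS k) => match s with end)) B)
        (fun i => if i is 0 then yg else y0) (fun _ _ _ => True)
        (vform (Vex 3 (Vrel2 XD 2 3))) by exists z.
  apply: (@fam_transfer f noS (fun k s => match s with end) _ 1 (fun _ _ => g'))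
 => //;
    [move=> b e E _ e2 | case=> // _].
  - apply/vformP => /=; have [x] := cdom_inh C (sval (e 2)).
    by exists (inEl (cdomD (ok.1 _ _ e2 gk) (svalP x))) => /=; apply: (svalP x).
  - exact: realizes_extends f0g.
have /choice[retr retrP] : forall x, exists y : El N, (exists y', iota y' = x) -> iota y = x.
  move=> x; have [[y e]|n] := EM (exists y', iota y' = x); first by exists y.
  by exists n0.
(* A function symbol of [tau'] that translates no symbol of the chain may lead out of N, so values
   are brought back by [retr]. On translated symbols nothing changes, by [closed] below. *)
pose A : structure (sym shifted) (El N) := @Structure (sym shifted) (El N)
  (fun n s xs => @rel_int _ _ B n.+1 s (scons y0 (fun m => iota (xs m))))
  (fun n s xs => retr (@fun_int _ _ B n.+1 s (scons y0 (fun m => iota (xs m))))).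
exists shifted, N, A; split; first by constructor.
exists restrictions; split; first exact: restrictions_forth.
move=> f' [f [Ff ff0 f'f]] phi [a ag Ta].
have sphi : sentence phi by apply/(sentence_fmap (@pincl _ _ f'))/(cthy_sentence C ag _ Ta).
have [_ _ Fx] := F_forth.
have aD : a ∈ D by apply: kappaD; apply: ok.1 ag gk.
pose a' : X := inEl aD.
have [f1 [Ff1 f1f f1a]] := Fx f [:: existT (fun k => sym ulang k) (Fun 0)
  (uconst kappa_inf kappaD tag_inh t0 (fun=> a'))] Ff.
have f1f0 : extends f1 f0 by move=> k s w /ff0/f1f.
have [ya f1ya] : exists ya, realizes f1 (fun=> a') ya.
  move: (f1a _ _ (or_introl erefl)); case e: (f1 _ _) => [w|] // _.
  by exists (fun_int B w (@nil0 _)), w.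
have pP k (s : pdom f' k) : f1 (up k) (uenc (fam_usym (pincl s))) = Some (pval s).
  case: s => s hs; have [w e] : exists w, f' k s = Some w.
    by move: hs; case: (f' k s) => [w|] // _; exists w.
  by apply/f1f/f'f; rewrite (pval_Some hs e).
pose h (i : nat) : X -> X := if i is 1 then fun=> a' else fun=> g'.
pose env (ts : nat -> El M) (i : nat) : El M :=
  match i with 0 => yg | 1 => ya | 2 => y0 | i.+3 => ts i end.
have hP ts i : i < 2 -> realizes f1 (h i) (env ts i).
  by case: i => [|[]] // _; apply: realizes_extends f0g.
have closed n (s : pdom f' (Fun n)) xs : exists y, iota y =
    @fun_int _ _ B n.+1 (pval s) (scons y0 (fun m : 'I_n => iota (xs m))).
  apply/iP.
  pose ts i := oapp (fun m => iota (xs m)) y0 (insub i).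
  pose psi := (fam_dom (@tapp (family_sym (pdom f')) n.+1 (XS s)
       (scons (tvar _ 2) (fun m : 'I_n => tvar _ (3 + m))))).
  have : sat (reduct (fam_v (@pval _ _ f')) B) (env ts) (fun _ _ _ => True) psi.
    apply: (@fam_transfer f1 _ (@pincl _ _ f') _ 2 h) => //; last exact: hP.
    move=> b e E ih e2.
    rewrite /psi /fam_dom /=; case: (cid _) => y /=; rewrite scons0 => yP.
    exact: (yP (ok.1 _ _ e2 gk)).1.
  rewrite /psi /fam_dom /= eval_fam_dom /= scons_map /=.
  have -> // : (fun m : 'I_n => ts m) = fun m => iota (xs m).
  by apply/funext => m; rewrite /ts valK.
apply/models_fmap => d G.
apply: (iffLR (@sat_fam_interp _ _ _ _ (reduct (fam_v (@pval _ _ f')) B) iota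
  (env (fun=> y0)) iI iP _ _ phi d (fun _ _ _ => True) G sphi)) => //.
  by move=> n s xs /=; rewrite retrP //; apply: closed.
(* In D the transferred statement says that every model with index v < g and not v < a satisfies
   phi; this holds because T_a is contained in T_v. In B it is applied to the index [y0], which is
   not below the image of a. *)
suff /vformP : sat (reduct (fam_v (@pval _ _ f')) B) (env (fun=> y0)) (fun _ _ _ => True)
    (vform (Vimp (Vnot (Vrel2 XE 2 1))
       (Vform (finterp 3 (@fam_dom _) (@fam_rel _) (@fam_fun _) phi)))).
  by apply; apply: y0_large f1ya.
apply: (@fam_transfer f1 _ (@pincl _ _ f') (@pval _ _ f') 2 h) => //; last exact: hP.
move=> b e E ih e2.
apply/vformP => /= e21.
have e2a : ~ sval (e 2) ∈ a.
  by move=> h2; apply: e21; rewrite (ih 1) //; apply: sE_mem.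
have og := ord_mem ok gk.
have e2k : sval (e 2) ∈ kappa by apply: ok.1 e2 gk.
have Te2 : cthy C (sval (e 2)) (fmap (@pincl _ _ f') phi).
  case: (ord_trich (ord_mem og ag) (ord_mem og e2)) => [ae|<- //|//].
  refine (cthy_mono C ae e2 _ Ta).
have mod := cstr_models C e2 _ Te2.
pose inc (y : El (cdom C (sval (e 2)))) : X := inEl (cdomD e2k (svalP y)).
have incI : injective inc by move=> x y /(congr1 sval) ex; apply: val_El_inj.
have [c0] := cdom_inh C (sval (e 2)).
apply: (iffRL (@sat_fam_interp _ _ _ (reduct (@pincl _ _ f') (cstr C (sval (e 2)))) _
  inc e incI _ _ _ phi (fun=> c0) E (fun _ _ _ => True) sphi)).
- move=> x /=; split=> [xd|[y <-]]; last exact: (svalP y).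
  by exists (inEl xd); apply: val_El_inj.
- move=> n s xs; rewrite /= /fam_relP scons0; split=> [[ys e']|h'].
    suff -> : ys = xs by [].
    by apply/funext => i; apply: val_El_inj; rewrite e' sconsS.
  by exists xs => // i; rewrite sconsS.
- move=> n s xs /=; case: (cid _) => y /=; rewrite scons0 => yP.
  by apply: val_El_inj; apply: (yP e2k).2 => i; rewrite sconsS.
by have /models_fmap := mod; apply.
Qed.

End Descent.

(** * The critical point and the forcing *)

Lemma tup2_eta T (f : 'I_2 -> T) : f = tup2 (f ord0) (f ord_max).
Proof.
by apply/funext => -[[|[|m]] hm] //=; congr f; apply: val_inj.
Qed.

Lemma In_iota m n i : m <= i < m + n -> List.In i (iota m n).
Proof.
elim: n m => [|n IH] m /=; first by rewrite addn0 ltnNge; case: leqP.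
rewrite -addSnnS leq_eqVlt => /andP[/orP[/eqP->|mi] h]; first by left.
by right; apply: IH; rewrite mi.
Qed.

Section MembershipInterpretation.

Definition in_dom (t : term level_sym) : formula level_sym := frel LU (tup1 t).
Definition in_rel n : in_sym (Rel n) -> ('I_n -> term level_sym) -> formula level_sym :=
  match n return in_sym (Rel n) -> ('I_n -> term level_sym) -> formula level_sym with
  | 2 => fun _ ts => frel LE ts
  | _ => fun s => match s with end
  end.
Definition in_fun n (s : in_sym (Fun n)) : ('I_n -> term level_sym) -> term level_sym :=
  match s with end.

Lemma sat_in_interp (N Y : Type) (R : N -> N -> Prop) (C : structure level_sym Y)
    (iota : N -> Y) :
  injective iota ->
  (forall y, rel_int C LU (tup1 y) <-> exists x, iota x = y) ->
  (forall x x', rel_int C LE (tup2 (iota x) (iota x')) <-> R x x') ->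
  forall phi e d E G, first_order phi -> (forall i, free1 phi i -> e i = iota (d i)) ->
    sat C e E (finterp 0 in_dom in_rel in_fun phi) <-> sat (in_structure R) d G phi.
Proof.
move=> iI hU hE phi e d E G fo h.
apply: (sat_finterp (e0 := e) iI) => //.
- by move=> e' E' t _; apply: iff_sym; rewrite -hU.
- case=> [|[|[|n]]] //= r e' E' ts xs _ hts; rewrite [X in rel_int _ _ X]tup2_eta.
  by rewrite !hts hE.
- by move=> n j hf; case: (first_order_free2 fo hf).
Qed.

End MembershipInterpretation.

Section Embedding.
Variables (V : zfc) (kappa alpha D : V) (tag : kind -> V).
Hypothesis kappa_inf : infinite_cardinal kappa.
Hypothesis oalpha : ordinal alpha.
Hypothesis kappa_alpha : kappa ∈ alpha.
Hypothesis levelD : forall x, in_level alpha x -> x ∈ D.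
Hypothesis tag_inh : forall k, inhabited (El (tag k)).
Variable C : forall g : V, chain g.
Hypothesis cdomD : forall g b x, g ∈ kappa -> b ∈ kappa -> x ∈ cdom (C g) b -> x ∈ D.
Hypothesis ctauT : forall g k s, g ∈ kappa -> s ∈ ctau (C g) k -> s ∈ tag (up k).
Hypothesis no_pm : forall g, g ∈ kappa -> infinite_cardinal g ->
  ~ chain_has_pseudo_model (C g).

Lemma below_kappaD x : x ∈ kappa -> x ∈ D.
Proof. by move=> xk; apply/levelD/in_level_ord => //; apply: oalpha.1 xk _. Qed.

Let X := El D.
Local Notation ulang := (ulang kappa_inf below_kappaD tag_inh).
Local Notation uenc := (@uenc V kappa D tag kappa_inf below_kappaD tag_inh _).
Local Notation utheory := (@utheory V kappa D tag kappa_inf below_kappaD tag_inh).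

Variables (tau' : language V) (M : V) (B : structure (sym tau') (El M)).
Variable F : pmap (sym ulang) (sym tau') -> Prop.
Hypothesis M_inh : inhabited (El M).
Hypothesis F_forth : omega_forth_system F.
Hypothesis F_model : forall f, F f -> forall phi : formula (pdom f),
  (exists2 a, a ∈ kappa & utheory a (fmap (@pincl _ _ f) phi)) ->
  models B (fmap (@pval _ _ f) phi).
Variable t : forall k, El (tag k).
Local Notation realizes :=
  (@realizes V kappa D tag kappa_inf below_kappaD tag_inh tau' M B (t (Fun 0))).
Local Notation uconst :=
  (@uconst V kappa D tag kappa_inf below_kappaD tag_inh (t (Fun 0))).

Definition level_u k (s : level_sym k) : usym D tag k :=
  match s in level_sym k return usym D tag k with
  | LU => (t (Rel 1), fun xs : 'I_1 -> X => in_level alpha (sval (xs ord0)))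
  | LE => (t (Rel 2), fun xs : 'I_2 -> X =>
      [/\ in_level alpha (sval (xs ord0)), in_level alpha (sval (xs ord_max))
        & sval (xs ord0) ∈ sval (xs ord_max)])
  | LR => (t (Rel 2), fun xs : 'I_2 -> X =>
      in_level (sval (xs ord0)) (sval (xs ord_max)))
  | LO => (t (Rel 1), fun xs : 'I_1 -> X => sval (xs ord0) ∈ alpha)
  end.

Lemma extends_trans (f f' f'' : pmap (sym ulang) (sym tau')) :
  extends f'' f' -> extends f' f -> extends f'' f.
Proof. by move=> h h' k s w /h'/h. Qed.

Lemma realizes_fun f h y y' : realizes f h y -> realizes f h y' -> y = y'.
Proof. by move=> [w [e <-]] [w' [e' <-]]; move: e'; rewrite e => -[->]. Qed.

Lemma realizes_total f (l : seq (X -> X)) : F f ->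
  exists f', [/\ F f', extends f' f & forall h, List.In h l -> exists y, realizes f' h y].
Proof.
move=> Ff; have [_ _ Fx] := F_forth.
have [f' [Ff' ff' d]] := Fx f
  (List.map (fun h => existT (fun k => sym ulang k) (Fun 0) (uconst h)) l) Ff.
exists f'; split=> // h hl.
have := d (Fun 0) (uconst h) (List.in_map _ _ _ hl).
case e: (f' _ _) => [w|] // _; by exists (fun_int B w (@nil0 _)), w.
Qed.

(** All later conditions extend this [g0], so they speak of one and the same copy of a level in
    B. *)
Lemma level_symbols : exists g0 (v : forall k, level_sym k -> sym tau' k),
  F g0 /\ forall k (s : level_sym k), g0 k (uenc (level_u s)) = Some (v k s).
Proof.
have [_ F0 Fx] := F_forth.
pose mk k (s : level_sym k) := existT (fun k => sym ulang k) k (uenc (level_u s)).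
have [g0 [Fg0 _ d]] := Fx _ [:: mk _ LU; mk _ LE; mk _ LR; mk _ LO] F0.
have ex k (s : level_sym k) : exists w, g0 k (uenc (level_u s)) = Some w.
  have := d k (uenc (level_u s)); case: (g0 k _) => [w _|]; first by exists w.
  by case: s => h; exfalso; suff : false by []; apply: h; rewrite /mk /=; tauto.
by exists g0, (fun k s => sval (cid (ex k s))); split=> // k s; apply: (svalP (cid (ex k s))).
Qed.

Variables (g0 : pmap (sym ulang) (sym tau')) (v : forall k, level_sym k -> sym tau' k).
Hypothesis Fg0 : F g0.
Hypothesis g0v : forall k (s : level_sym k), g0 (uenc (level_u s)) = Some (v s).

Local Notation U y := (rel_int B (v LU) (tup1 y)).
Local Notation E x y := (rel_int B (v LE) (tup2 x y)).
Local Notation R x y := (rel_int B (v LR) (tup2 x y)).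
Local Notation O y := (rel_int B (v LO) (tup1 y)).

Lemma level_transfer f n (h : nat -> X -> X) (phi : formula level_sym) (a : V) :
  F f -> extends f g0 -> a ∈ kappa ->
  (forall b : X, sval b ∈ kappa -> ~ sval b ∈ a -> forall e G,
     (forall i, i < n -> e i = h i b) ->
     sat (reduct level_u (universal tag b)) e G phi) ->
  forall e G, (forall i, i < n -> realizes f (h i) (e i)) ->
    sat (reduct v B) e G phi.
Proof.
move=> Ff fg0 ak H; apply: (transfer F_model Ff _ ak H) => k s.
exact/fg0/g0v.
Qed.

Let k0 : num V 0 ∈ kappa.
Proof. exact: infinite_num. Qed.

Lemma pseudo_level_axioms :
  level_axioms (fun y => U y) (fun x y => E x y) (fun x y => R x y) (fun y => O y).
Proof.
apply: (level_formulaP (reduct v B) M_inh).1 => e G.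
apply: (level_transfer (n := 0) (h := fun _ x => x) Fg0 (fun _ _ _ e => e) k0) => // b _ _ e' G' _.
have inhX : inhabited X by constructor; exact: (inEl (below_kappaD k0)).
apply: (level_formulaP (reduct level_u (universal tag b)) inhX).2 => /=.
exact: level_axioms_level.
Qed.

Variables (beta : V) (p : El M -> V).
Hypothesis obeta : ordinal beta.
Hypothesis pP : forall y z, z ∈ p y <-> exists2 x, E x y & p x = z.
Hypothesis pI : forall x y, U x -> U y -> p x = p y -> x = y.
Hypothesis pO : forall b, O b -> p b ∈ beta.
Hypothesis levelP : forall z, in_level beta z <-> exists2 x, U x & p x = z.

Lemma realizes_U f (x : X) y : F f -> extends f g0 -> in_level alpha (sval x) ->
  realizes f (fun=> x) y -> U y.
Proof.
move=> Ff fg0 ax fx.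
have /vformP : sat (reduct v B) (fun=> y) (fun _ _ _ => True) (vform (Vrel1 LU 0)).
  apply: (level_transfer (n := 1) (h := fun _ _ => x) Ff fg0 k0) => //.
  by move=> b _ _ e G h; rewrite vformP /= h.
by [].
Qed.

Lemma realizes_O f (x : X) y : F f -> extends f g0 -> sval x ∈ alpha ->
  realizes f (fun=> x) y -> O y.
Proof.
move=> Ff fg0 ax fx.
have /vformP : sat (reduct v B) (fun=> y) (fun _ _ _ => True) (vform (Vrel1 LO 0)).
  apply: (level_transfer (n := 1) (h := fun _ _ => x) Ff fg0 k0) => //.
  by move=> b _ _ e G h; rewrite vformP /= h.
by [].
Qed.

Lemma realizes_E f (h h' : X -> X) y y' a : F f -> extends f g0 -> a ∈ kappa ->
  (forall b : X, sval b ∈ kappa -> ~ sval b ∈ a ->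
     [/\ in_level alpha (sval (h b)), in_level alpha (sval (h' b))
       & sval (h b) ∈ sval (h' b)]) ->
  realizes f h y -> realizes f h' y' -> E y y'.
Proof.
move=> Ff fg0 ak H fh fh'.
have /vformP : sat (reduct v B) (fun i => if i is 0 then y else y') (fun _ _ _ => True)
    (vform (Vrel2 LE 0 1)).
  apply: (level_transfer (n := 2) (h := fun i => if i is 0 then h else h') Ff fg0 ak).
    by move=> b bk ba e G hh; rewrite vformP /= !hh //; apply: H.
  by case=> [|[]].
by [].
Qed.

Lemma E_p x y : U x -> U y -> (E x y <-> p x ∈ p y).
Proof.
move=> Ux Uy; split=> [xy|/pP[z zy e]]; first by apply/pP; exists x.
by have [Uz _] := la_dom pseudo_level_axioms zy; rewrite -(pI Uz Ux e).
Qed.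

Definition elX x (ax : in_level alpha x) : X := inEl (levelD ax).

Lemma level_below_alpha x : x ∈ alpha -> in_level alpha x.
Proof. exact: in_level_ord. Qed.

Lemma below_kappa_alpha x : x ∈ kappa -> x ∈ alpha.
Proof. by move=> xk; apply: oalpha.1 xk kappa_alpha. Qed.

Definition moves f (x : X) : Prop :=
  [/\ F f, extends f g0 & exists2 y, realizes f (fun=> x) y & p y <> sval x].

(** Suppose all are fixed. As c < kappa, the value of c collapses to an element of the image of
    kappa, hence to some a < kappa. But a < c belongs to T_(a+1), where a+1 < kappa because kappa is
    a limit; so the image of a, which is a, is an element of a. The constant c is [id] in the
    code. *)
Lemma some_moved : exists f x, moves f x /\ (sval x ∈ kappa \/ sval x = kappa).
Proof.
apply: contrapT => nm.
have fixed f x y : F f -> extends f g0 -> sval x ∈ kappa \/ sval x = kappa ->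
    realizes f (fun=> x) y -> p y = sval x.
  move=> Ff fg0 hx fxy; apply: contrapT => ne; apply: nm; exists f, x.
  by split=> //; split=> //; exists y.
have [[ok _] _] := kappa_inf.
pose xk : X := elX (level_below_alpha kappa_alpha).
have [f [Ff fg0 hf]] := realizes_total [:: id; fun=> xk] Fg0.
have [yc fyc] := hf id (or_introl erefl).
have [yk fyk] := hf _ (or_intror (or_introl erefl)).
have pyk : p yk = kappa by apply: (fixed f xk yk Ff fg0 _ fyk); right.
have Ecy : E yc yk.
  apply: (realizes_E (a := num V 0) Ff fg0 k0) fyc fyk => b bk _.
  by split; [apply/level_below_alpha/below_kappa_alpha | apply: level_below_alpha |].
have ack : p yc ∈ kappa.
  by rewrite -[X in _ ∈ X]pyk; apply/pP; exists yc.
pose xa : X := inEl (below_kappaD ack).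
have [f' [Ff' f'f hf']] := realizes_total [:: fun=> xa] Ff.
have [ya fya] := hf' _ (or_introl erefl).
have f'g0 := extends_trans f'f fg0.
have pya : p ya = p yc by apply: (fixed f' xa ya Ff' f'g0 _ fya); left.
have Eac : E ya yc.
  apply: (realizes_E (a := osucc (p yc)) Ff' f'g0 _) fya (realizes_extends f'f fyc).
    exact: infinite_cardinal_limit.
  move=> b bk ba; split; try exact/level_below_alpha/below_kappa_alpha.
  have := ord_trich (ord_mem ok ack) (ord_mem ok bk).
  by case=> // h; case: ba; apply/osuccP; [right | left].
have : p ya ∈ p yc by apply/pP; exists ya.
by rewrite pya => /mem_irrefl.
Qed.

(** * The least moved ordinal *)

Section FirstMoved.
Variables (f : pmap (sym ulang) (sym tau')) (x : X) (yx : El M).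
Hypothesis Ff : F f.
Hypothesis fg0 : extends f g0.
Hypothesis fx : realizes f (fun=> x) yx.
Hypothesis yx_moved : p yx <> sval x.
Hypothesis xk : sval x ∈ kappa.
Hypothesis fixed : forall f' x' y', F f' -> extends f' g0 -> sval x' ∈ sval x ->
  realizes f' (fun=> x') y' -> p y' = sval x'.

Let g := sval x.
Let ordg : ordinal g.
Proof. by have [[ok _] _] := kappa_inf; apply: ord_mem ok xk. Qed.

Let below_g a : a ∈ g -> a ∈ kappa.
Proof. by have [[ok _] _] := kappa_inf => ag; apply: ok.1 ag xk. Qed.

Let realize_below (f' : pmap (sym ulang) (sym tau')) a : F f' -> extends f' f -> a ∈ g ->
  exists (f'' : pmap (sym ulang) (sym tau')) (a' : X) (y : El M),
    [/\ F f'', extends f'' f', sval a' = a, realizes f'' (fun=> a') y & p y = a].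
Proof.
move=> Ff' f'f ag; pose a' : X := inEl (below_kappaD (below_g ag)).
have [f'' [Ff'' f''f' h]] := realizes_total [:: fun=> a'] Ff'.
have [y fy] := h _ (or_introl erefl); exists f'', a', y; split=> //.
by apply: (fixed (x' := a') Ff'' _ _ fy) => //; apply: extends_trans f''f' (extends_trans f'f fg0).
Qed.

Let level_kappa a : a ∈ kappa -> in_level alpha a.
Proof. by move=> ak; apply/level_below_alpha/below_kappa_alpha. Qed.

(** Each a < g is fixed and lies below the image of g, so g is included in that image; being moved,
    g is a proper initial segment and thus an element of it. *)
Lemma moved_point : exists k1, [/\ U k1, E k1 yx & p k1 = g].
Proof.
have pord : ordinal (p yx).
  by apply: (ord_mem obeta); apply/pO/(realizes_O Ff fg0 _ fx)/below_kappa_alpha.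
have gsub a : a ∈ g -> a ∈ p yx.
  move=> ag; have [f' [a' [y [Ff' f'f ea fa pya]]]] := realize_below Ff (fun _ _ _ e => e) ag.
  apply/pP; exists y => //.
  apply: (realizes_E (a := num V 0) Ff' (extends_trans f'f fg0) k0) fa (realizes_extends f'f fx).
  by move=> b _ _; rewrite ea; split=> //; apply: level_kappa => //; apply: below_g.
have gp : g ∈ p yx.
  case: (ord_trich ordg pord) => // [e|pg]; first by case: yx_moved.
  by case: (mem_irrefl (gsub _ pg)).
have [k1 k1y e] := (pP _ _).1 gp.
by exists k1; split=> //; have [] := la_dom pseudo_level_axioms k1y.
Qed.

(** If g is 0, its image has no element, against [moved_point]. If g = n+1, every element of the
    image of g is the image of n or below it, and n is fixed, so g itself would be at most n. *)
Lemma first_moved_not_num n : g <> num V n.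
Proof.
move=> gn; have [k1 [Uk1 Ek1 pk1]] := moved_point.
case: n gn => [|n] gn.
  have /vformP : sat (reduct v B) (fun i => if i is 0 then yx else k1) (fun _ _ _ => True)
      (vform (Vnot (Vrel2 LE 1 0))).
    apply: (level_transfer (n := 1) (h := fun _ _ => x) Ff fg0 k0).
      move=> b _ _ e G h; rewrite vformP /= (h 0) // => -[_ _].
      by rewrite -/g gn => /num0P.
    by case.
  by apply.
have ng : num V n ∈ g by rewrite gn; apply/osuccP; right.
have [f' [a' [y [Ff' f'f ea fa pya]]]] := realize_below Ff (fun _ _ _ e => e) ng.
pose env i := match i with 0 => yx | 1 => y | _ => k1 end.
have /vformP : sat (reduct v B) env (fun _ _ _ => True)
    (vform (Vimp (Vrel2 LE 2 0) (Vimp (Vnot (Vrel2 LE 2 1)) (Veq _ 2 1)))).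
  apply: (level_transfer (n := 2) (h := fun i _ => if i is 0 then x else a') Ff'
    (extends_trans f'f fg0) k0).
    move=> b _ _ e G h; rewrite vformP /= (h 0) // (h 1) // => -[ae2 ax].
    rewrite -/g gn => /osuccP[e2|e2]; last by move=> _; apply: val_El_inj; rewrite ea.
    by case; split=> //; rewrite ea //; apply: level_kappa; apply: below_g.
  by case=> [_|[]//]; apply: realizes_extends f'f fx.
move=> /= /(_ Ek1) h; case: (EM (E k1 y)) => [k1y|/h ey].
  have : p k1 ∈ p y by apply/pP; exists k1.
  by rewrite pk1 pya => /(mem_asym ng).
by move: ng; rewrite -pya -ey pk1 => /mem_irrefl.
Qed.

Let no_sym (k : kind) : Type := Empty_set.

(** The graph of h is a symbol. By surjectivity [k1], which collapses to g, is related to some m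
    below the image of l, and m collapses to an element of l. That element and its value c under h
    are both below g, hence fixed; as the translated graph is single-valued, [k1] is the image of c,
    so g = c < g. *)
Lemma first_moved_cardinal l (h : El l -> El g) : l ∈ g -> ~ bijective h.
Proof.
move=> lg [h' hh' h'h]; have [k1 [Uk1 Ek1 pk1]] := moved_point.
pose sH : usym D tag (Rel 2) := (t (Rel 2), fun xs : 'I_2 -> X =>
  exists2 u, sval u = sval (xs ord0) & sval (h u) = sval (xs ord_max)).
have [_ _ Fx] := F_forth.
have [f1 [Ff1 f1f dH]] := Fx f
  [:: existT (fun k => sym ulang k) (Rel 2) (uenc sH)] Ff.
have [wH f1H] : exists wH, f1 (Rel 2) (uenc sH) = Some wH.
  by have := dH _ _ (or_introl erefl); case: (f1 _ _) => [w|] // _; exists w.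
have [f2 [l' [yl [Ff2 f2f1 el fl pyl]]]] := realize_below Ff1 f1f lg.
have f2f := extends_trans f2f1 f1f.
(* [family_sym] over the empty language serves as a language with two binary symbols: [XE] for
   membership and [XD] for the graph of h. *)
pose u2 k (s : family_sym no_sym k) : usym D tag k :=
  match s in family_sym _ k return usym D tag k with
  | XE => level_u LE | XD => sH | XS _ s => match s with end end.
pose v2 k (s : family_sym no_sym k) : sym tau' k :=
  match s in family_sym _ k return sym tau' k with
  | XE => v LE | XD => wH | XS _ s => match s with end end.
have fuv (f' : pmap (sym ulang) (sym tau')) : extends f' f1 ->
    forall k (s : family_sym no_sym k), f' k (uenc (u2 k s)) = Some (v2 k s).
  move=> f'f1 k [||k' []] /=; last exact: f'f1.
  by apply/f'f1/f1f/fg0; apply: (g0v LE).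
pose env i := match i with 0 => yx | 1 => yl | _ => k1 end.
have /vformP : sat (reduct v2 B) env (fun _ _ _ => True)
    (vform (Vimp (Vrel2 XE 2 0) (Vex 3 (Vand (Vrel2 XE 3 1) (Vrel2 XD 3 2))))).
  apply: (transfer F_model (t0 := t (Fun 0)) (n := 2) (h := fun i _ => if i is 0 then x else l') Ff2
    (fuv _ f2f1) k0).
    move=> b _ _ e G he; rewrite vformP /= (he 0) // => -[ae2 ax e2g].
    pose u := h' (inEl e2g); have ul := svalP u.
    have uk : sval u ∈ kappa by apply: below_g; apply: ordg.1 ul lg.
    exists (inEl (below_kappaD uk)); split.
      rewrite /= /upd /= (he 1) // el; split=> //; apply: level_kappa => //.
      exact: below_g.
    by exists u => //=; rewrite h'h.
  by case=> [_|[]//]; apply: realizes_extends f2f fx.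
move=> /= /(_ Ek1)[m []]; rewrite /upd /= => Eml Hmk.
have [Um _] := la_dom pseudo_level_axioms Eml.
have pml : p m ∈ l by rewrite -pyl; apply/pP; exists m.
have [f3 [m' [ym [Ff3 f3f2 em fm pym]]]] := realize_below Ff2 f2f (ordg.1 _ _ pml lg).
have f3f := extends_trans f3f2 f2f.
pose c := h (inEl pml).
have [f4 [c' [yc [Ff4 f4f3 ec fc pyc]]]] := realize_below Ff3 f3f (svalP c).
have f4f1 := extends_trans f4f3 (extends_trans f3f2 f2f1).
(* The element m was obtained only as a witness in B. Since p is injective on U, it is also the
   image of a point of D. *)
have emm : ym = m.
  apply: pI => //; apply: (realizes_U Ff3 (extends_trans f3f fg0) _ fm).
  by rewrite em; apply/level_kappa/below_g/(ordg.1 _ _ pml lg).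
pose env' i := match i with 0 => m | 1 => yc | _ => k1 end.
have /vformP : sat (reduct v2 B) env' (fun _ _ _ => True)
    (vform (Vimp (Vrel2 XD 0 2) (Veq _ 1 2))).
  apply: (transfer F_model (t0 := t (Fun 0)) (n := 2) (h := fun i _ => if i is 0 then m' else c') Ff4
    (fuv _ f4f1) k0).
    move=> b _ _ e G he; rewrite vformP /= (he 0) // (he 1) // => -[u eu hu].
    apply: val_El_inj; rewrite -hu ec; congr (sval (h _)); apply: val_El_inj.
    by rewrite eu em.
  by case=> [_|[]//]; rewrite /env' -emm; apply: realizes_extends f4f3 fm.
move=> /= /(_ Hmk) ek; have cg := svalP c.
by move: cg; rewrite -pyc ek pk1 => /mem_irrefl.
Qed.

Lemma first_moved_false : False.
Proof.
have ig : infinite_cardinal g.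
  split; first by split=> // l lg [h /(first_moved_cardinal lg)].
  by move=> n [h /(finite_ord ordg)[m /first_moved_not_num]].
apply: (no_pm xk ig); have [k1 [Uk1 Ek1 pk1]] := moved_point.
pose s := @sD V D tag g (C g) (t (Rel 2)).
have [_ _ Fx] := F_forth.
have [f1 [Ff1 f1f dH]] := Fx f [:: existT (fun k => sym ulang k) (Rel 2) (uenc s)] Ff.
have [wD f1D] : exists wD, f1 (Rel 2) (uenc s) = Some wD.
  by have := dH _ _ (or_introl erefl); case: (f1 _ _) => [w|] // _; exists w.
have f1g0 := extends_trans f1f fg0.
refine (descent (g := g) (C := C g) xk (fun b x => @cdomD g b x xk)
  (fun k s => @ctauT g k s xk) F_forth F_model (t0 := t (Fun 0)) (sE := level_u LE)
  (wE := v LE) (f1g0 _ _ _ (g0v LE)) f1D (g' := x) (realizes_extends f1f fx) Ek1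
  _ _ _ _) => //.
- move=> f2 a y Ff2 f2f1 ag fa k1y.
  have pya := fixed Ff2 (extends_trans f2f1 f1g0) ag fa.
  have : p k1 ∈ p y by apply/pP; exists k1.
  by rewrite pk1 pya => /(mem_asym ag).
- by move=> b [].
- move=> b a ag ba; split=> //; last exact/level_kappa/below_g.
  by apply: in_level_trans oalpha.1 (level_kappa (below_g ag)) ba.
- by exists f1.
Qed.

End FirstMoved.

Lemma critical_point : exists f x, [/\ moves f x, sval x = kappa
  & forall f' x' y', F f' -> extends f' g0 -> sval x' ∈ kappa ->
      realizes f' (fun=> x') y' -> p y' = sval x'].
Proof.
have [f [x [mx xk]]] := some_moved.
move ex : (sval x) => g; move: g f x ex mx xk; elim/mem_ind => g IH f x ex mx xk.
have [[f' [x' [mx' x'g]]]|n] := EM (exists f' x', moves f' x' /\ sval x' ∈ g).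
  apply: (IH _ x'g _ _ erefl mx'); left; have [[ok _] _] := kappa_inf.
  by case: xk => xk; [apply: ok.1 x'g _; rewrite -ex | rewrite -xk ex].
have fixed f' x' y' : F f' -> extends f' g0 -> sval x' ∈ sval x ->
    realizes f' (fun=> x') y' -> p y' = sval x'.
  move=> Ff' f'g0 x'x fy; apply: contrapT => ne; apply: n.
  by exists f', x'; rewrite -ex; split=> //; split=> //; exists y'.
case: xk => xk; last first.
  exists f, x; split=> // f' x' y' Ff' f'g0 x'k.
  by apply: fixed; rewrite // xk.
case: mx => Ff fg0 [y fy py].
by case: (first_moved_false Ff fg0 fy py xk fixed).
Qed.

(** * Elementarity of the partial maps induced by F *)

Definition level_elt (x : level alpha) : X := elX (svalP x).

Lemma level_inj (a : V) : injective (fun x : level a => sval x).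
Proof. by move=> [x hx] [y hy] /= e; subst y; rewrite (Prop_irrelevance hx hy). Qed.

Lemma level_eltI : injective level_elt.
Proof. by move=> x y /(congr1 sval) /level_inj. Qed.

Lemma back_map : exists b : level beta -> El M,
  [/\ forall y, p (b y) = sval y, forall y, U (b y) & forall z, U z -> exists y, b y = z].
Proof.
have /choice[b bP] : forall y : level beta, exists z, U z /\ p z = sval y.
  by move=> y; have [z] := (levelP _).1 (svalP y); exists z.
exists b; split=> [y|y|z Uz]; try by case: (bP y).
have bz : in_level beta (p z) by apply/levelP; exists z.
exists (exist (fun y => in_level beta y) _ bz).
by have [Ub e] := bP (exist (fun y => in_level beta y) _ bz); apply: pI.
Qed.

Variable back : level beta -> El M.
Hypothesis backE : forall y, p (back y) = sval y.
Hypothesis backU : forall y, U (back y).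
Hypothesis back_surj : forall z, U z -> exists y, back y = z.

Lemma backI : injective back.
Proof. by move=> y z e; apply: level_inj; rewrite -!backE e. Qed.

Lemma level_sat_transfer f (phi : formula in_sym) e d :
  F f -> extends f g0 -> first_order phi ->
  (forall i, free1 phi i -> realizes f (fun=> level_elt (e i)) (back (d i))) ->
  holds (level_structure alpha) e phi -> holds (level_structure beta) d phi.
Proof.
move=> Ff fg0 fo hf he G; have [n nP] := free1_bound phi.
have hE (y y' : level beta) : E (back y) (back y') <-> sval y ∈ sval y'.
  by rewrite E_p // !backE.
(* Transfer asks for a value at every index below n. At indices that are not free in phi the value
   of c is used. *)
pose h i := if `[< free1 phi i >] then fun _ : X => level_elt (e i) else id.
have [f' [Ff' f'f hf']] := realizes_total [:: id] Ff.
have [yid fid] := hf' _ (or_introl erefl).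
pose env i := if `[< free1 phi i >] then back (d i) else yid.
have envE i : free1 phi i -> env i = back (d i) by rewrite /env; case: asboolP.
have hU y : U y <-> exists x, back x = y by split=> [/back_surj|[x <-]].
apply: (iffLR (sat_in_interp (C := reduct v B) backI hU hE (fun _ _ _ => True) G fo envE)).
apply: (level_transfer (n := n) (h := h) Ff' (extends_trans f'f fg0) k0).
  move=> b _ _ e' G' ih.
  apply: (iffRL (sat_in_interp (C := reduct level_u (universal tag b)) level_eltI _ _ G'
    (fun _ _ _ => True) fo _)) (he _).
  - move=> y; split=> /= [ay|[z <-]]; last exact: (svalP z).
    by exists (exist (fun x => in_level alpha x) _ ay); apply: val_El_inj.
  - by move=> x x' /=; split=> [[]|] //; split=> //; [apply: (svalP x) | apply: (svalP x')].
  - by move=> i hi; rewrite ih ?nP // /h; case: asboolP.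
move=> i _; rewrite /h /env; case: asboolP => // hi.
exact: realizes_extends f'f (hf i hi).
Qed.

(** [holds] quantifies over second-order assignments, so failure of phi has to be turned into
    [holds] of its negation for the converse half of elementarity. The interpretation lemma gives
    this at once, since for first-order formulas it leaves the two assignments unrelated. *)
Lemma level_sat_indep (phi : formula in_sym) e G G' : first_order phi ->
  sat (level_structure alpha) e G phi -> sat (level_structure alpha) e G' phi.
Proof.
move=> fo; pose b : X := inEl (below_kappaD k0).
pose A := reduct level_u (universal tag b).
have hU y : rel_int A LU (tup1 y) <-> exists x, level_elt x = y.
  split=> /= [ay|[z <-]]; last exact: (svalP z).
  by exists (exist (fun x => in_level alpha x) _ ay); apply: val_El_inj.
have hE x x' : rel_int A LE (tup2 (level_elt x) (level_elt x')) <-> sval x ∈ sval x'.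
  by split=> /= [[]|] //; split=> //; [apply: (svalP x) | apply: (svalP x')].
pose G0 : assignment2 X := fun _ _ _ => True.
move=> s; apply: (iffLR (sat_in_interp (C := A) level_eltI hU hE (e := fun i => level_elt (e i)) G0 G' fo _)) => //.
by apply: (iffRL (sat_in_interp (C := A) level_eltI hU hE (e := fun i => level_elt (e i)) G0 G fo _)).
Qed.

Lemma level_elementary f (phi : formula in_sym) e d :
  F f -> extends f g0 -> first_order phi ->
  (forall i, free1 phi i -> realizes f (fun=> level_elt (e i)) (back (d i))) ->
  holds (level_structure alpha) e phi <-> holds (level_structure beta) d phi.
Proof.
move=> Ff fg0 fo hf; split=> [|hd]; first exact: (level_sat_transfer Ff fg0 fo hf).
move=> G; apply: contrapT => ns.
have : holds (level_structure beta) d (fnot phi).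
  apply: (level_sat_transfer (phi := fnot phi) Ff fg0 fo hf) => G' s.
  exact: ns (level_sat_indep _ fo s).
by move=> /(_ (fun _ _ _ => True)); apply; apply: hd.
Qed.

(** * Forcing with the partial maps *)

Definition trace f : level alpha * level beta -> Prop :=
  fun z => realizes f (fun=> level_elt z.1) (back z.2).

(* Finite information about the embedding; only the partial map induced by f is
   kept, because this makes the conditions a set of V. *)
Definition condition : Type :=
  {q : level alpha * level beta -> Prop |
    exists f, [/\ F f, extends f g0 & q = trace f]}.

Lemma small_level (a : V) : small V (level a).
Proof.
have [s sP] := level_set a; exists s, (fun x : level a => sval x).
split=> [|x]; first exact: level_inj.
by apply/sP; exact: (svalP x).
Qed.

Lemma small_condition : small V condition.
Proof.
apply: (small_inj (g := fun q : condition => sval q) _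
  (small_pred (small_prod (small_level alpha) (small_level beta)))).
by move=> [q hq] [r hr] /= e; subst r; rewrite (Prop_irrelevance hq hr).
Qed.

Definition stronger (q r : condition) : Prop := forall z, sval r z -> sval q z.

Lemma trace_fun (q : condition) x y y' :
  sval q (x, y) -> sval q (x, y') -> y = y'.
Proof.
have [f [_ _ e]] := svalP q; rewrite e => h h'.
by apply: backI; apply: realizes_fun h h'.
Qed.

Lemma conditions_dense (q : condition) (l : seq (level alpha)) :
  exists f (r : condition), [/\ F f, extends f g0, sval r = trace f, stronger r q
    & forall x, List.In x l -> exists y, sval r (x, y)].
Proof.
have [f [Ff fg0 e]] := svalP q.
have [f' [Ff' f'f h]] := realizes_total (List.map (fun x _ => level_elt x) l) Ff.
have f'g0 := extends_trans f'f fg0.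
have hr : exists f, [/\ F f, extends f g0 & trace f' = trace f] by exists f'.
exists f', (exist _ (trace f') hr); split=> // [z|x xl]; first by rewrite e; apply: realizes_extends.
have [y fy] := h _ (List.in_map (fun x _ => level_elt x) l x xl).
have [y' ey] := back_surj (realizes_U (x := level_elt x) Ff' f'g0 (svalP x) fy).
by exists y'; rewrite /= /trace /= ey.
Qed.

Lemma virtual_embedding : virtual_embedding_with_crit alpha beta kappa.
Proof.
have [f1 [x1 [[Ff1 f1g0 [y1 f1y1 y1k]] x1k fixed]]] := critical_point.
have hq1 : exists f, [/\ F f, extends f g0 & trace f1 = trace f] by exists f1.
(* This condition already sends kappa to a value other than kappa, so it forces kappa to be
   moved. *)
pose q1 : condition := exist _ (trace f1) hq1.
have [P [enc [dec K]]] := small_code small_condition (inhabits q1).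
pose le (q r : El P) := stronger (dec q) (dec r).
have le_refl q : le q q by [].
have le_trans q r s : le q r -> le r s -> le q s by move=> h h' z /h'/h.
(* The name of the union of the partial maps in the generic filter. *)
pose j : rel_name (El P) (level alpha) (level beta) := fun x y c => sval (dec c) (x, y).
have f_inI x y q : sval (dec q) (x, y) -> f_in le j x y q.
  by move=> h r rq; exists r => //; exists q.
have f_inE x y q : f_in le j x y q -> exists2 r, le r q & sval (dec r) (x, y).
  by move=> /(_ q (le_refl q))[r rq [c rc h]]; exists r => //; apply: rc.
have dense q x : exists r, le r q /\ exists y, sval (dec r) (x, y).
  have [f [r [_ _ _ rq h]]] := conditions_dense (dec q) [:: x].
  have [y ry] := h x (or_introl erefl).
  by exists (enc r); rewrite /le K; split=> //; exists y.
exists P, le; split; first by split.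
exists (enc q1), j; split; [split|split; [|split]].
- move=> x q _; have [r [rq [y ry]]] := dense q x.
  by exists r => //; exists y; apply: f_inI.
- move=> x y z q _ [hy hz]; have [r rq ry] := f_inE _ _ _ hy.
  have [r' r'r [c r'c cz]] := hz r rq.
  by apply: (@trace_fun (dec r') x); [apply: r'r | apply: r'c].
- move=> [phi fo] e d q _ /= hin; have [n nP] := free1_bound phi.
  (* A single r below q is defined at [e i] for all i < n. Its values agree with the [d i] forced by
     q, because both appear in a common extension; so one member of F realizes all the pairs
     needed. *)
  have [f [r [Ff fg0 er rq h]]] := conditions_dense (dec q) (List.map e (iota 0 n)).
  apply: (level_elementary Ff fg0 fo) => i hi.
  have [y ry] : exists y, sval r (e i, y).
    by apply: h; apply: List.in_map; apply: In_iota; rewrite /= nP.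
  have lerq : le (enc r) q by rewrite /le K.
  have [r' r'r [c r'c cd]] := hin (exist _ i hi) (enc r) lerq.
  have -> : d i = y.
    apply: (@trace_fun (dec r') (e i)); first exact: r'c.
    by apply: r'r; rewrite K.
  by move: ry; rewrite er.
- move=> [x xk] q _; have [r [rq [y ry]]] := dense q x.
  exists r => //; have py : sval y = sval x.
    have [f [Ff fg0 er]] := svalP (dec r).
    move: ry; rewrite er -(backE y) => fxy.
    exact: (fixed f (level_elt x) (back y) Ff fg0 xk fxy).
  by exists (exist _ y py); apply: f_inI.
- move=> q qq1; exists q => //.
  have ax1 : in_level alpha (sval x1) by rewrite x1k; apply: level_below_alpha.
  pose x : level alpha := exist _ _ ax1.
  have xk : sval x = kappa by [].
  exists (exist _ x xk) => q' q'q; exists q' => //.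
  have ex : level_elt x = x1 by apply: val_El_inj.
  have [y ey] := back_surj (realizes_U Ff1 f1g0 ax1 f1y1).
  have yk : sval y <> kappa by rewrite -backE ey -x1k.
  exists (exist _ y yk); apply: f_inI => /=.
  apply: q'q; apply: qq1; rewrite K /= /trace /= ex ey.
  exact: f1y1.
Qed.

End Embedding.

Theorem theorem4p13 (V : zfc) (kappa : V) :
  omega_pseudo_chain_compact kappa ->
  (forall mu : V, omega_pseudo_chain_compact mu -> mu = kappa \/ kappa ∈ mu) ->
  weakly_virtually_extendible kappa.
Proof.
move=> kc kmin alpha oalpha ka; have [kappa_inf _] := kc.
have [C CP] := witness_chains V.
have [S SP] := level_set alpha.
have [d dP] := union2_bound kappa (fun g b => cdom (C g) b).
have [D DP] := binary_union S d.
have levelD x : in_level alpha x -> x ∈ D by move=> /SP h; apply/DP; left.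
have cdomD g b x : g ∈ kappa -> b ∈ kappa -> x ∈ cdom (C g) b -> x ∈ D.
  by move=> gk bk xg; apply/DP; right; apply: dP gk bk xg.
(* The tags contain the symbols of all chains below kappa, with the arity shifted back by [down],
   and 0 as the tag of the symbols that belong to no chain. *)
have /choice[tag tagP] : forall k, exists s : V, num V 0 ∈ s /\
    forall g x, g ∈ kappa -> x ∈ ctau (C g) (down k) -> x ∈ s.
  move=> k; have [c cP] := union_bound kappa (fun g => ctau (C g) (down k)).
  have [e eP] := singleton_set (num V 0); have [s sP] := binary_union c e.
  exists s; split=> [|g x gk xg]; apply/sP; first by right; apply/eP.
  by left; apply: cP gk xg.
pose t k : El (tag k) := inEl (tagP k).1.
have tag_inh k : inhabited (El (tag k)) by constructor; exact: t.
have ctauT g k s : g ∈ kappa -> s ∈ ctau (C g) k -> s ∈ tag (up k).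
  by move=> gk sg; apply: (tagP (up k)).2 gk _; case: k sg.
have no_pm g : g ∈ kappa -> infinite_cardinal g -> ~ chain_has_pseudo_model (C g).
  move=> gk ig; apply: CP => // /kmin[e|kg]; last exact: mem_asym gk kg.
  by move: gk; rewrite e => /mem_irrefl.
pose kD := below_kappaD oalpha ka levelD.
have [tau' [M [B [M_inh [F [F_forth F_model]]]]]] :=
  utheory_pseudo_model kappa_inf kD tag_inh kc.
have [g0 [v [Fg0 g0v]]] := level_symbols F_forth t.
have ax := pseudo_level_axioms M_inh F_model Fg0 g0v.
have [beta [p [obeta pP pI pO levelP]]] := collapse_level ax.
have [b [bE bU bS]] := back_map pI levelP.
exists beta => //.
exact: (virtual_embedding cdomD ctauT no_pm M_inh F_forth F_model Fg0 g0v obeta pP pI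
  pO bE bU bS).
Qed.
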